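(* Let $\mathbf{A}$ be a finite forest of finite rooted trees with $m$ nodes in total, and let $k$ be a positive integer with $k\le\lfloor\log_2 m\rfloor$. One can compute in $O(m^3)$ time a forest $\mathbf{X}$ with $\mathbf{X}^k=\mathbf{A}$, or determine that no such forest exists.
   Context: Rooted trees are in-trees (arcs oriented toward the root); the depth of a node is its distance to the root. The product of two rooted trees $\mathbf{t}_1=(V_1,E_1)$, $\mathbf{t}_2=(V_2,E_2)$ is the rooted tree with vertex set $\{(v,u)\in V_1\times V_2\mid \mathrm{depth}(v)=\mathrm{depth}(u)\}$ and arcs $((v,u),(v',u'))$ whenever $(v,v')\in E_1$ and $(u,u')\in E_2$. A forest is a multiset of rooted trees up to isomorphism; the product of two forests is the multiset of all pairwise products of their trees. $\mathbf{X}^k$ denotes the product of $k$ copies of $\mathbf{X}$. Equality means isomorphism. *)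

(* Defs.v *)
From HB Require Import structures.
From mathcomp Require Import all_boot.
From Stdlib Require List.

Set Implicit Arguments.
Unset Strict Implicit.
Unset Printing Implicit Defensive.

(* Arcs point towards the root: the last three conditions say that the root has
   out-degree 0, that out-degrees are at most 1, and that every vertex has a
   directed path to the root. *)
Record rooted_tree := RootedTree {
  vertex : finType;
  arc : rel vertex;
  root : vertex;
  root_sink : forall v, ~~ arc root v;
  arc_functional : forall v w w', arc v w -> arc v w' -> w = w';
  root_reachable : forall v, connect arc v root
}.
Arguments arc {r}.
Arguments root {r}.

Section Depth.
Variable t : rooted_tree.
Implicit Types v w : vertex t.

Definition walk_to_root v (n : nat) : bool :=
  [exists p : n.-tuple (vertex t), path arc v p && (last v p == root)].

Lemma walk_to_root_ex v : exists n, walk_to_root v n.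
Proof.
have /connectP[p pp rp] := root_reachable v; exists (size p).
by apply/existsP; exists (in_tuple p); rewrite pp -rp eqxx.
Qed.

Definition depth v : nat := ex_minn (walk_to_root_ex v).

Lemma walk_to_root0 v : walk_to_root v 0 = (v == root).
Proof.
apply/existsP/idP => [[p]|vr]; first by rewrite (tuple0 p).
by exists [tuple].
Qed.

Lemma walk_to_rootS v n :
  reflect (exists2 w, arc v w & walk_to_root w n) (walk_to_root v n.+1).
Proof.
apply: (iffP existsP) => [[p]|[w vw /existsP[p wp]]].
  case/tupleP: p => w p /= /andP[/andP[vw wp] lp]; exists w => //.
  by apply/existsP; exists p; rewrite wp.
by exists [tuple of w :: p]; rewrite /= vw.
Qed.

Lemma walk_to_root_uniq n m v :
  walk_to_root v n -> walk_to_root v m -> n = m.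
Proof.
elim: n m v => [|n IHn] [|m] v //.
- rewrite walk_to_root0 => /eqP-> /walk_to_rootS[w rw _].
  by rewrite (negPf (root_sink w)) in rw.
- move=> /walk_to_rootS[w rw _]; rewrite walk_to_root0 => /eqP vr.
  by move: rw; rewrite vr (negPf (root_sink w)).
move=> /walk_to_rootS[w vw wn] /walk_to_rootS[w' vw' wm].
by congr _.+1; apply: (IHn _ w) => //; rewrite (arc_functional vw vw').
Qed.

Lemma depthE v n : (depth v == n) = walk_to_root v n.
Proof.
rewrite /depth; case: ex_minnP => d vd _.
by apply/eqP/idP => [<- // | /(walk_to_root_uniq vd)].
Qed.

Lemma depth_root : depth root = 0.
Proof. by apply/eqP; rewrite depthE walk_to_root0. Qed.

Lemma depth_eq0 v : (depth v == 0) = (v == root).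
Proof. by rewrite depthE walk_to_root0. Qed.

Lemma depthS v n :
  reflect (exists2 w, arc v w & depth w = n) (depth v == n.+1).
Proof.
rewrite depthE; apply: (iffP (walk_to_rootS v n)) => -[w vw].
  by rewrite -depthE => /eqP; exists w.
by move/eqP; rewrite depthE; exists w.
Qed.

End Depth.

Section Product.
Variables t1 t2 : rooted_tree.

Definition prod_vertex :=
  {p : vertex t1 * vertex t2 | depth p.1 == depth p.2}.

Definition prod_arc : rel prod_vertex :=
  fun p q => arc (val p).1 (val q).1 && arc (val p).2 (val q).2.

Lemma prod_root_depth :
  depth (root : vertex t1) == depth (root : vertex t2).
Proof. by rewrite !depth_root. Qed.

Definition prod_root : prod_vertex := exist _ (root, root) prod_root_depth.

Lemma prod_root_sink q : ~~ prod_arc prod_root q.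
Proof. by rewrite /prod_arc /= negb_and root_sink. Qed.

Lemma prod_arc_functional p q q' : prod_arc p q -> prod_arc p q' -> q = q'.
Proof.
move=> /andP[a1 a2] /andP[b1 b2]; apply/val_inj.
rewrite (surjective_pairing (val q)) (surjective_pairing (val q')).
by rewrite (arc_functional a1 b1) (arc_functional a2 b2).
Qed.

Lemma prod_root_reachable p : connect prod_arc p prod_root.
Proof.
have [n] := ubnP (depth (val p).1); elim: n p => // n IHn [[v u] /= vu].
case dv: (depth v) => [|d] ltdn.
  suff -> : exist _ (v, u) vu = prod_root by [].
  apply/val_inj => /=; congr pair; apply/eqP; rewrite -depth_eq0 ?dv //.
  by rewrite -(eqP vu) dv.
have /depthS[v' vv' dv'] : depth v == d.+1 by rewrite dv.
have /depthS[u' uu' du'] : depth u == d.+1 by rewrite -(eqP vu) dv.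
have vu' : depth (v', u').1 == depth (v', u').2 by rewrite /= dv' du'.
apply: (@connect_trans _ _ (exist _ (v', u') vu')).
  by apply: connect1; rewrite /prod_arc /= vv'.
by apply: IHn; rewrite /= dv'.
Qed.

Definition tree_mul : rooted_tree :=
  RootedTree prod_root_sink prod_arc_functional prod_root_reachable.

End Product.

Definition tree_iso (t1 t2 : rooted_tree) : Prop :=
  exists f : vertex t1 -> vertex t2,
    [/\ bijective f, f root = root & forall v w, arc (f v) (f w) = arc v w].

(* A finite multiset of trees is a finite family, up to reindexing. *)
Record forest := Forest {
  forest_index : finType;
  tree_of : forest_index -> rooted_tree
}.
Arguments tree_of {f}.

Definition forest_iso (A B : forest) : Prop :=
  exists f : forest_index A -> forest_index B,
    bijective f /\ forall i, tree_iso (tree_of i) (tree_of (f i)).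

Definition forest_size (A : forest) : nat :=
  \sum_(i : forest_index A) #|vertex (tree_of i)|.

Definition forest_mul (A B : forest) : forest :=
  Forest (fun p : forest_index A * forest_index B => tree_mul (tree_of p.1) (tree_of p.2)).

(* Only meaningful for 0 < k; the value at k = 0 is junk. *)
Definition forest_pow (X : forest) (k : nat) : forest :=
  iter k.-1 (forest_mul X) X.

(* First-order, call-by-value pure Lisp.  Data are binary cons cells; there are
   no numbers and no equality test, so every evaluation step is a constant
   amount of work on a pointer machine or on a RAM with logarithmic word size
   (values being shared, not copied). *)
Inductive data := DNil | DCons (x y : data).

(* Variables are de Bruijn indices.  In [ECase e e0 e1], the branch [e1] binds
   the head (index 0) and the tail (index 1) of the value of [e].
   [ECall f es] calls the [f]-th function of the program, whose body sees the
   [i]-th argument as variable [i]. *)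
Inductive expr :=
| EVar (i : nat)
| ENil
| ECons (e1 e2 : expr)
| ECase (e e0 e1 : expr)
| ELet (e1 e2 : expr)
| ECall (f : nat) (es : seq expr).

(* The list of the (mutually recursive) function bodies; the entry point is
   function 0. *)
Definition program := seq expr.

(* [eval P env e v n]: in environment [env], [e] evaluates to [v] in time [n],
   where every evaluated expression node costs one unit.  A program being
   fixed, environment and argument-list lengths are bounded, so that each node
   does take constant time.  Out-of-range variables denote [DNil], undefined
   functions have body [ENil]. *)
Inductive eval (P : program) : seq data -> expr -> data -> nat -> Prop :=
| eval_var env i : eval P env (EVar i) (nth DNil env i) 1
| eval_nil env : eval P env ENil DNil 1
| eval_cons env e1 e2 v1 v2 n1 n2 :
    eval P env e1 v1 n1 -> eval P env e2 v2 n2 ->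
    eval P env (ECons e1 e2) (DCons v1 v2) (n1 + n2).+1
| eval_case_nil env e e0 e1 v n n0 :
    eval P env e DNil n -> eval P env e0 v n0 ->
    eval P env (ECase e e0 e1) v (n + n0).+1
| eval_case_cons env e e0 e1 x y v n n1 :
    eval P env e (DCons x y) n -> eval P (x :: y :: env) e1 v n1 ->
    eval P env (ECase e e0 e1) v (n + n1).+1
| eval_let env e1 e2 v1 v2 n1 n2 :
    eval P env e1 v1 n1 -> eval P (v1 :: env) e2 v2 n2 ->
    eval P env (ELet e1 e2) v2 (n1 + n2).+1
| eval_call env f es vs v n1 n2 :
    evals P env es vs n1 -> eval P vs (nth ENil P f) v n2 ->
    eval P env (ECall f es) v (n1 + n2).+1
with evals (P : program) :
    seq data -> seq expr -> seq data -> nat -> Prop :=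
| evals_nil env : evals P env [::] [::] 0
| evals_cons env e es v vs n1 n2 :
    eval P env e v n1 -> evals P env es vs n2 ->
    evals P env (e :: es) (v :: vs) (n1 + n2).

Definition computes_in (P : program) (args : seq data) (v : data) (n : nat) :=
  eval P args (nth ENil P 0) v n.

(* So [computes_in] is a partial function of the program and its inputs. *)
Scheme eval_mut_ind := Induction for eval Sort Prop
with evals_mut_ind := Induction for evals Sort Prop.

Local Ltac use_IH := repeat match goal with
  | IH : (forall v n, eval ?P ?env ?e v n -> _), H : eval ?P ?env ?e _ _ |- _ =>
      destruct (IH _ _ H); clear IH H
  | IH : (forall v n, evals ?P ?env ?e v n -> _),
    H : evals ?P ?env ?e _ _ |- _ => destruct (IH _ _ H); clear IH H
  | H : DCons _ _ = DCons _ _ |- _ => injection H as ? ?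
  | _ => progress subst
  | _ => discriminate
  end.

Lemma eval_deterministic P env e v n v' n' :
  eval P env e v n -> eval P env e v' n' -> v = v' /\ n = n'.
Proof.
move=> H; move: v' n'; move: env e v n H.
apply: (@eval_mut_ind P
  (fun env e v n _ => forall v' n', eval P env e v' n' -> v = v' /\ n = n')
  (fun env es vs n _ =>
     forall vs' n', evals P env es vs' n' -> vs = vs' /\ n = n')).
- by move=> env i v' n' H; inversion H.
- by move=> env v' n' H; inversion H.
- by move=> env ? ? ? ? ? ? _ ? _ ? v' n' H; inversion H; use_IH.
- by move=> env ? ? ? ? ? ? _ ? _ ? v' n' H; inversion H; use_IH.
- by move=> env ? ? ? ? ? ? ? ? _ ? _ ? v' n' H; inversion H; use_IH.
- by move=> env ? ? ? ? ? ? _ ? _ ? v' n' H; inversion H; use_IH.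
- by move=> env ? ? ? ? ? ? _ ? _ ? v' n' H; inversion H; use_IH.
- by move=> env vs' n' H; inversion H.
- by move=> env ? ? ? ? ? ? _ ? _ ? vs' n' H; inversion H; use_IH.
Qed.

Definition dlist (s : seq data) : data := foldr DCons DNil s.

Definition unary (n : nat) : data := dlist (nseq n DNil).

(* A vertex is written as the list of the codes of its children, taken in any
   order; in particular isomorphic trees may have different codes, and a code
   determines its tree up to isomorphism.  A tree with m vertices is written
   with exactly m - 1 cons cells. *)
Inductive vertex_code (t : rooted_tree) : vertex t -> data -> Prop :=
| VertexCode (v : vertex t) (us : seq (vertex t)) (cs : seq data) :
    uniq us -> (forall u, (u \in us) = arc u v) ->
    List.Forall2 (@vertex_code t) us cs ->
    vertex_code v (dlist cs).

Definition tree_code (t : rooted_tree) (c : data) : Prop :=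
  vertex_code (root : vertex t) c.

Definition forest_code (A : forest) (c : data) : Prop :=
  exists (ix : seq (forest_index A)) (cs : seq data),
    [/\ uniq ix, forall i, i \in ix,
        List.Forall2 (fun i => tree_code (tree_of i)) ix cs & c = dlist cs].

Lemma forest_code_ex A : exists c, forest_code A c.
Proof.
suff tree_code_ex t : exists c, tree_code t c.
  have [cs csP] : exists cs,
      List.Forall2 (fun i => tree_code (tree_of i)) (enum (forest_index A)) cs.
    elim: (enum _) => [|i ix [cs csP]]; first by exists [::].
    have [c cP] := tree_code_ex (tree_of i).
    by exists (c :: cs); constructor.
  exists (dlist cs), (enum (forest_index A)), cs; split=> //; first exact: enum_uniq.
  by move=> i; rewrite mem_enum.
suff code_ex n (v : vertex t) : \max_(w : vertex t) depth w <= n + depth v ->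
    exists c, vertex_code v c.
  by apply: (code_ex (\max_(w : vertex t) depth w)); rewrite leq_addr.
elim: n v => [|n IHn] v dv.
  exists (dlist [::]); apply: (@VertexCode _ _ [::]) => // u; rewrite in_nil.
  apply/esym/negP => uv; have : depth u == (depth v).+1.
    by apply/depthS; exists v.
  by move/eqP => du; have := leq_trans (leq_bigmax u) dv; rewrite du add0n ltnn.
have [cs csP] : exists cs,
    List.Forall2 (@vertex_code t) (enum [pred u | arc u v]) cs.
  have : all (fun u => arc u v) (enum [pred u | arc u v]).
    by apply/allP => u; rewrite mem_enum.
  elim: (enum _) => [|u us IHus] /=; first by exists [::].
  case/andP=> uv /IHus[cs csP].
  have /eqP du : depth u == (depth v).+1 by apply/depthS; exists v.
  have [|c cP] := IHn u; first by rewrite du addnS -addSn.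
  by exists (c :: cs); constructor.
exists (dlist cs); apply: (VertexCode _ _ csP); first exact: enum_uniq.
by move=> u; rewrite mem_enum.
Qed.

(* Main.v *)
Require Import Defs.
From mathcomp Require Import all_boot.
From HB Require Import structures.
From mathcomp Require Import zify.
From Stdlib Require List.
(* Imported again because [path] and [fingraph] also define [arc] and [root]. *)
Import Defs.

Set Implicit Arguments.
Unset Strict Implicit.
Unset Printing Implicit Defensive.

(* Products are compared through a total order on isomorphism classes.  A tree is
   the list of its child trees; once all lists are sorted in decreasing order,
   trees and forests are compared lexicographically.  A tree of smaller height is
   smaller, and x < y implies xz < yz whenever z is at least as high as y.
   Hence x |-> x^k is strictly increasing on forests, and k-th roots are unique.

   If X^k = A, then x^k is a tree of A for every tree x of X, so X is a
   sub-multiset of the list R of the k-th roots of the trees of A.  The k-th root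
   of a tree is obtained recursively, as that of the forest of its children.  Run
   through R in decreasing order, adding c to the part Y of X found so far if and
   only if (Y + c)^k is contained in A.  This never adds a wrong tree: if all trees
   of X - Y are smaller than c, then cX < c(Y + c), so c^k X^k < c^k (Y + c)^k, and
   (Y + c)^k is not contained in X^k.

   Each test takes time O(m^2), because products are formed in time linear in
   their size and the computation of (Y + c)^k is given up as soon as an
   intermediate power has more than m vertices.  Over all levels of the recursion
   there is one test for each vertex, and one final check for each forest. *)

Implicit Types (x y z : data) (s : seq data).

(** * Canonical codes *)

Lemma data_eq_dec : comparable data.
Proof. rewrite /comparable /decidable; decide equality. Defined.

HB.instance Definition _ := hasDecEq.Build data (compareP data_eq_dec).

(** A forest and the tree obtained by joining its trees under a new root have the same code, so
    every [data] can be read both ways. *)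
Fixpoint kids x : seq data := if x is DCons a b then a :: kids b else [::].

Lemma dlistK : cancel dlist kids.
Proof. by elim=> //= a s ->. Qed.

Lemma kidsK : cancel kids dlist.
Proof. by elim=> //= a _ b ->. Qed.

(** For the code of a forest this is its number of vertices; for that of a tree, one less. *)
Fixpoint cells x : nat := if x is DCons a b then (cells a + cells b).+1 else 0.

Lemma cells_dlist s : cells (dlist s) = \sum_(a <- s) (cells a).+1.
Proof. by elim: s => [|a s IHs] /=; rewrite ?big_nil // big_cons IHs; lia. Qed.

Lemma cellsE x : cells x = \sum_(a <- kids x) (cells a).+1.
Proof. by rewrite -cells_dlist kidsK. Qed.

Lemma cells_kid a x : a \in kids x -> cells a < cells x.
Proof.
by elim: x => //= b _ c IHc; rewrite inE => /predU1P[->|/IHc]; lia.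
Qed.

Lemma data_kids_ind (P : data -> Prop) :
  (forall x, (forall a, a \in kids x -> P a) -> P x) -> forall x, P x.
Proof.
move=> Pkids x; have [n] := ubnP (cells x); elim: n x => // n IHn x ltxn.
by apply: Pkids => a /cells_kid ltax; apply: IHn; lia.
Qed.

(* The lexicographic order on binary trees; on lists sorted in decreasing order
   it is the multiset extension of the order on the elements. *)
Fixpoint leD x y : bool :=
  match x, y with
  | DNil, _ => true
  | DCons _ _, DNil => false
  | DCons a b, DCons c d => if a == c then leD b d else leD a c
  end.

Definition ltD x y := ~~ leD y x.
Definition geD x y := leD y x.

Lemma leD_refl : reflexive leD.
Proof. by elim=> //= a _ b ->; rewrite eqxx. Qed.

Lemma leD_anti : antisymmetric leD.
Proof.
elim=> [|a IHa b IHb] [|c d] //=; rewrite (eq_sym c a).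
by case: eqP => [-> /IHb-> // | neq_ac /IHa].
Qed.

Lemma leD_total : total leD.
Proof.
elim=> [|a IHa b IHb] [|c d] //=; rewrite (eq_sym c a).
by case: eqP => [_|_]; [apply: IHb | apply: IHa].
Qed.

Lemma leD_trans : transitive leD.
Proof.
move=> y x; elim: x y => [|a IHa b IHb] [|c d] [|e f] //=.
have [-> | neq_ac] := eqVneq a c; first by case: eqP => // _; apply: IHb.
have [<- | neq_ce] := eqVneq c e; first by rewrite (negPf neq_ac).
have [-> le1 le2 | _] := eqVneq a e; last exact: IHa.
by case/eqP: neq_ce; apply: leD_anti; rewrite le1 le2.
Qed.

Lemma geD_trans : transitive geD.
Proof. by move=> y x z /= le_yx le_zy; apply: leD_trans le_zy le_yx. Qed.

Lemma geD_total : total geD.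
Proof. by move=> x y; apply: leD_total. Qed.

Lemma geD_anti : antisymmetric geD.
Proof. by move=> x y; rewrite andbC => /leD_anti. Qed.

Lemma ltDW x y : ltD x y -> leD x y.
Proof. by rewrite /ltD; have /orP[-> // | ->] := leD_total x y. Qed.

Lemma ltD_irr x : ltD x x = false.
Proof. by rewrite /ltD leD_refl. Qed.

Lemma leD_lt_trans x y z : leD x y -> ltD y z -> ltD x z.
Proof. by move=> le_xy; apply: contra => /leD_trans; apply. Qed.

Lemma ltD_le_trans x y z : ltD x y -> leD y z -> ltD x z.
Proof. by move=> lt_xy le_yz; apply: contra lt_xy => /(leD_trans le_yz). Qed.

Lemma ltD_trans x y z : ltD x y -> ltD y z -> ltD x z.
Proof. by move/ltDW; apply: leD_lt_trans. Qed.

Lemma ltD_neqAle x y : ltD x y = (x != y) && leD x y.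
Proof.
apply/idP/andP => [lt_xy | [neq_xy le_xy]].
  by split; [apply: contraTneq lt_xy => ->; rewrite ltD_irr | apply: ltDW].
by apply: contra neq_xy => le_yx; apply/eqP/leD_anti; rewrite le_xy.
Qed.

Lemma ltD_total x y : [\/ ltD x y, x = y | ltD y x].
Proof.
have [-> | neq_xy] := eqVneq x y; first by constructor 2.
have /orP[le_xy | le_yx] := leD_total x y.
  by constructor 1; rewrite ltD_neqAle neq_xy.
by constructor 3; rewrite ltD_neqAle eq_sym neq_xy.
Qed.

Fixpoint insD x l : data :=
  if l is DCons y l' then if leD y x then DCons x l else DCons y (insD x l')
  else DCons x DNil.

(** Insertion sort at every level; the result represents the isomorphism class. *)
Fixpoint canon x : data :=
  if x is DCons a b then insD (canon a) (canon b) else DNil.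

Lemma perm_insD x l : perm_eq (kids (insD x l)) (x :: kids l).
Proof.
elim: l => //= y _ l IHl; case: ifP => _ //=.
apply: perm_trans (_ : perm_eq _ [:: y, x & kids l]) _; first by rewrite perm_cons.
exact/permP/(fun P => addnCA _ _ _).
Qed.

Lemma sorted_insD x l : sorted geD (kids l) -> sorted geD (kids (insD x l)).
Proof.
elim: l => //= y _ l IHl sl; case: ifP => [le_yx | /negbT lt_xy] /=.
  by rewrite {1}/geD le_yx.
rewrite path_sortedE; last exact: geD_trans.
rewrite IHl ?(path_sorted sl) // andbT (perm_all _ (perm_insD x l)) /=.
by rewrite (order_path_min geD_trans) // andbT; apply: ltDW.
Qed.

Lemma kids_canon x : kids (canon x) = sort geD (map canon (kids x)).
Proof.
suff [srt prm] : sorted geD (kids (canon x)) /\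
    perm_eq (kids (canon x)) (map canon (kids x)).
  apply: (sorted_eq geD_trans geD_anti) => //; first exact/sort_sorted/geD_total.
  by rewrite perm_sym perm_sort perm_sym.
elim: x => //= a _ b [srt prm]; split; first exact: sorted_insD.
by rewrite (perm_trans (perm_insD _ _)) ?perm_cons.
Qed.

Lemma sorted_canon x : sorted geD (kids (canon x)).
Proof. by rewrite kids_canon; apply/sort_sorted/geD_total. Qed.

Lemma perm_kids_canon x : perm_eq (kids (canon x)) (map canon (kids x)).
Proof. by rewrite kids_canon perm_sort. Qed.

Lemma canonP x y :
  reflect (canon x = canon y) (perm_eq (map canon (kids x)) (map canon (kids y))).
Proof.
apply: (iffP idP) => [prm | eq_xy].
  apply: (can_inj kidsK); rewrite !kids_canon.
  by apply/perm_sortP; [apply: geD_total | apply: geD_trans | apply: geD_anti |].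
by apply: perm_trans (perm_kids_canon y); rewrite -eq_xy perm_sym perm_kids_canon.
Qed.

Lemma canon_id x : canon (canon x) = canon x.
Proof.
elim/data_kids_ind: x => x IHx; apply/canonP.
rewrite (perm_trans (perm_map _ (perm_kids_canon x))) // -map_comp.
suff -> : map (canon \o canon) (kids x) = map canon (kids x) by [].
by apply/eq_in_map => a /IHx.
Qed.

Lemma canon_kid a x : a \in kids (canon x) -> canon a = a.
Proof.
by rewrite (perm_mem (perm_kids_canon x)) => /mapP[b _ ->]; rewrite canon_id.
Qed.

Lemma cells_canon x : cells (canon x) = cells x.
Proof.
elim/data_kids_ind: x => x IHx.
rewrite [LHS]cellsE (perm_big _ (perm_kids_canon x)) big_map [RHS]cellsE /=.
by apply: eq_big_seq => a /IHx ->.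
Qed.

(** * Products and heights *)

(** The child subtrees of the root of a product of trees are the pairwise products of child
    subtrees, so one function multiplies both trees and forests. The inner [fix] is [drow], inlined
    to make the recursion on [a] structural. *)
Fixpoint dmul x : data -> data :=
  if x is DCons a x' then fun y =>
    (fix drow z := if z is DCons b z' then DCons (dmul a b) (drow z') else dmul x' y) y
  else fun=> DNil.

Fixpoint drow x y z : data :=
  if y is DCons b y' then DCons (dmul x b) (drow x y' z) else z.

Lemma mul_cons a x y : dmul (DCons a x) y = drow a y (dmul x y).
Proof.
rewrite /=; move: (dmul x y) => w; elim: y => //= b _ y -> //.
Qed.

Lemma kids_row a y z : kids (drow a y z) = map (dmul a) (kids y) ++ kids z.
Proof. by elim: y => //= b _ y ->. Qed.

Lemma kids_mul x y : kids (dmul x y) = [seq dmul a b | a <- kids x, b <- kids y].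
Proof. by elim: x => // a _ x IHx; rewrite mul_cons kids_row IHx. Qed.

Lemma mulD0 x : dmul x DNil = DNil.
Proof. by elim: x => // a _ x IHx; rewrite mul_cons. Qed.

Lemma cells_mul x y : cells (dmul x y) <= cells x * cells y.
Proof.
elim/data_kids_ind: x y => x IHx y.
rewrite cellsE kids_mul big_allpairs_dep [cells x]cellsE big_distrl big_seq.
rewrite [leqRHS]big_seq; apply: leq_sum => a ax.
rewrite [cells y]cellsE big_distrr; apply: leq_sum => b _.
by have := IHx a ax b; rewrite /= mulSn mulnS; lia.
Qed.

Definition dcat x y := dlist (kids x ++ kids y).

Lemma kids_dcat x y : kids (dcat x y) = kids x ++ kids y.
Proof. exact: dlistK. Qed.

Lemma mulDl x y z : dmul (dcat x y) z = dcat (dmul x z) (dmul y z).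
Proof.
by apply: (can_inj kidsK); rewrite !(kids_mul, kids_dcat) allpairs_cat.
Qed.

(** Both sides list the triple products in the same lexicographic order, so associativity holds
    without [canon], unlike commutativity. *)
Lemma mulA x y z : dmul x (dmul y z) = dmul (dmul x y) z.
Proof.
elim/data_kids_ind: x y z => x IHx y z; apply: (can_inj kidsK); rewrite !kids_mul.
elim: (kids x) IHx => //= a s IHs IHx; rewrite allpairs_cat -IHs; last first.
  by move=> b bs; apply: IHx; rewrite inE bs orbT.
congr (_ ++ _); elim: (kids y) => //= b t IHt.
rewrite map_cat {}IHt -!map_comp; congr (_ ++ _).
by apply: eq_map => c /=; rewrite IHx ?mem_head.
Qed.

(** * Multiplicities of isomorphism classes in a forest *)

Definition mult x e := count_mem e (map canon (kids x)).

Lemma mult_sum x e : mult x e = \sum_(a <- kids x) (canon a == e).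
Proof. by rewrite /mult count_map -sum1_count big_mkcond. Qed.

Lemma canon_mult x y : canon x = canon y <-> mult x =1 mult y.
Proof.
split=> [/canonP/permP eq_xy e | eq_xy]; first exact: eq_xy.
by apply/canonP/allP => e _; apply/eqP/eq_xy.
Qed.

Lemma mult_dcat x y e : mult (dcat x y) e = mult x e + mult y e.
Proof. by rewrite /mult kids_dcat map_cat count_cat. Qed.

Lemma mult_mul x y e :
  mult (dmul x y) e = \sum_(a <- kids x) \sum_(b <- kids y) (canon (dmul a b) == e).
Proof. by rewrite mult_sum kids_mul big_allpairs_dep. Qed.

Lemma canon_mulC x y : canon (dmul x y) = canon (dmul y x).
Proof.
elim/data_kids_ind: x y => x IHx y; apply/canon_mult => e.
rewrite !mult_mul exchange_big; apply: eq_bigr => b _.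
by rewrite !big_seq; apply: eq_bigr => a /IHx->.
Qed.

Lemma canon_mulr x y : canon (dmul x (canon y)) = canon (dmul x y).
Proof.
elim/data_kids_ind: x y => x IHx y; apply/canon_mult => e; rewrite !mult_mul.
rewrite !big_seq; apply: eq_bigr => a ax.
rewrite (perm_big _ (perm_kids_canon y)) big_map.
by apply: eq_bigr => b _; rewrite IHx.
Qed.

Lemma canon_mull x y : canon (dmul (canon x) y) = canon (dmul x y).
Proof. by rewrite canon_mulC canon_mulr canon_mulC. Qed.

Lemma eq_canon_mul x x' y y' :
  canon x = canon x' -> canon y = canon y' -> canon (dmul x y) = canon (dmul x' y').
Proof.
by move=> eqx eqy; rewrite -canon_mull -canon_mulr eqx eqy canon_mull canon_mulr.
Qed.

Lemma canon_dcatC x y : canon (dcat x y) = canon (dcat y x).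
Proof. by apply/canon_mult => e; rewrite !mult_dcat addnC. Qed.

Lemma eq_canon_dcat x x' y y' :
  canon x = canon x' -> canon y = canon y' -> canon (dcat x y) = canon (dcat x' y').
Proof.
move=> /canon_mult eqx /canon_mult eqy.
by apply/canon_mult => e; rewrite !mult_dcat eqx eqy.
Qed.

Lemma canon_mulDr x y z : canon (dmul x (dcat y z)) = canon (dcat (dmul x y) (dmul x z)).
Proof. by rewrite canon_mulC mulDl; apply: eq_canon_dcat; apply: canon_mulC. Qed.

(** * Heights, and their monotonicity for the order *)

Fixpoint height x : nat :=
  if x is DCons a b then maxn (height a).+1 (height b) else 0.

Lemma heightE x : height x = \max_(a <- kids x) (height a).+1.
Proof. by elim: x => [|a _ b IHb] /=; rewrite ?big_nil // big_cons IHb. Qed.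

Lemma height_kid a x : a \in kids x -> height a < height x.
Proof.
move=> ax; rewrite [height x]heightE.
exact: (@leq_bigmax_seq data _ xpredT (fun a => (height a).+1)).
Qed.

Lemma height_leP x n : (forall a, a \in kids x -> height a < n) -> height x <= n.
Proof. by move=> le_n; rewrite heightE; apply/bigmax_leqP_seq => a /le_n. Qed.

Lemma height_max x n : n < height x -> exists2 a, a \in kids x & n <= height a.
Proof.
rewrite heightE; elim: (kids x) => [|a s IHs]; first by rewrite big_nil.
rewrite big_cons leq_max => /orP[le_na | /IHs[b bs le_nb]].
  by exists a; rewrite // mem_head.
by exists b; rewrite // inE bs orbT.
Qed.

Lemma height_canon x : height (canon x) = height x.
Proof.
elim/data_kids_ind: x => x IHx; rewrite [LHS]heightE [RHS]heightE.
rewrite (perm_big _ (perm_kids_canon x)) big_map.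
by apply: eq_big_seq => a /IHx ->.
Qed.

Lemma height_mul x y : height (dmul x y) = minn (height x) (height y).
Proof.
elim/data_kids_ind: x y => x IHx y; apply/eqP; rewrite eqn_leq; apply/andP; split.
  apply: height_leP => c; rewrite kids_mul => /allpairsP[[a b] /= [ax bx ->]].
  by rewrite IHx // leq_min !gtn_min (height_kid ax) (height_kid bx) orbT.
case def_n: (minn _ _) => [//|n].
have /height_max[a ax lea] : n < height x by lia.
have /height_max[b bx leb] : n < height y by lia.
apply: leq_trans (_ : (height (dmul a b)).+1 <= _); first by rewrite IHx //; lia.
by apply: height_kid; rewrite kids_mul allpairs_f.
Qed.

(** In a sorted list the head dominates every kid, and the head of [y] dominates that of [x]; by
    induction no kid of [x] is higher than the head of [y]. *)
Lemma leD_height x y : leD (canon x) (canon y) -> height x <= height y.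
Proof.
rewrite -(height_canon x) -(height_canon y).
have [n] := ubnP (height (canon x)); elim: n x y => // n IHn x y ltxn le_xy.
apply: height_leP => k kx; move: (kx) le_xy.
case def_x: (canon x) kx => [|a b] //; case def_y: (canon y) => [|c d] //= _ kx le_xy.
have [ax cy] : a \in kids (canon x) /\ c \in kids (canon y).
  by rewrite def_x def_y !mem_head.
have kx' : k \in kids (canon x) by rewrite def_x.
have le_ac : leD a c by case: eqP le_xy => // -> _; apply: leD_refl.
have le_ka : leD k a.
  have := sorted_canon x; rewrite def_x /= => /(order_path_min geD_trans)/allP sa.
  by case/predU1P: kx => [-> | /sa //]; apply: leD_refl.
rewrite (leq_trans _ (leq_maxl _ _)) // -(canon_kid kx') -(canon_kid cy) ltnS.
apply: IHn; first by rewrite (canon_kid kx') (leq_trans (height_kid kx')).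
by rewrite (canon_kid kx') (canon_kid cy) (leD_trans le_ka).
Qed.

(** * Compatibility of the order with products *)

Lemma count_above a s e : path geD a s -> ltD a e -> count_mem e (a :: s) = 0.
Proof.
move=> /(order_path_min geD_trans)/allP le_sa lt_ae; apply/count_memPn.
rewrite inE negb_or; apply/andP; split.
  by apply: contraTneq lt_ae => <-; rewrite ltD_irr.
by apply: contraL lt_ae => /le_sa le_ea; rewrite /ltD negbK.
Qed.

(** The witness is the entry of [y] at the first position where the two sorted lists differ:
    everything above it lies in the common prefix. *)
Lemma ltD_mult x y : ltD (canon x) (canon y) ->
  exists2 e, mult x e < mult y e & forall e', ltD e e' -> mult x e' = mult y e'.
Proof.
suff lex s t : sorted geD s -> sorted geD t -> ltD (dlist s) (dlist t) ->
    exists2 e, count_mem e s < count_mem e t &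
      forall e', ltD e e' -> count_mem e' s = count_mem e' t.
  rewrite -{1}[canon x]kidsK -{1}[canon y]kidsK => lt_xy.
  have [e lt_e eq_e] := lex _ _ (sorted_canon x) (sorted_canon y) lt_xy.
  have cE z e' : count_mem e' (kids (canon z)) = mult z e'.
    exact/permP/perm_kids_canon.
  by exists e => [|e' /eq_e]; rewrite -!cE.
elim: s t => [|a s IHs] [|c t] //= sas sct; rewrite /ltD /=.
  move=> _; exists c => [|e' lt_ce']; first by rewrite eqxx.
  by rewrite -[LHS]/(count_mem e' [::]) [RHS](count_above sct lt_ce').
case: (eqVneq c a) sas sct => [-> | neq_ca] sas sct.
  move/IHs => [||e lt_e eq_e]; [exact: path_sorted sas | exact: path_sorted sct |].
  by exists e => [|e' /eq_e ->]; rewrite // ltn_add2l.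
move=> lt_ac; exists c => [|e' lt_ce'].
  by rewrite -/(count_mem c (a :: s)) (count_above sas lt_ac) eqxx.
rewrite [LHS](count_above sas) ?[RHS](count_above sct) //.
exact: ltD_trans lt_ce'.
Qed.

Lemma mult_ltD x y e : mult x e < mult y e ->
  (forall e', ltD e e' -> mult x e' = mult y e') -> ltD (canon x) (canon y).
Proof.
move=> lt_e eq_e; have [// | eq_xy | ] := ltD_total (canon x) (canon y).
  by rewrite ((canon_mult x y).1 eq_xy) ltnn in lt_e.
case/ltD_mult => f lt_f eq_f; have [lt_ef | eq_ef | lt_fe] := ltD_total e f.
- by rewrite (eq_e _ lt_ef) ltnn in lt_f.
- by rewrite eq_ef in lt_e; have := ltn_trans lt_e lt_f; rewrite ltnn.
- by rewrite (eq_f _ lt_fe) ltnn in lt_e.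
Qed.

Definition msub x y := forall e, mult x e <= mult y e.

Lemma leD_msub x y : msub x y -> leD (canon x) (canon y).
Proof.
move=> sub_xy; apply: contraT => /ltD_mult[e].
by rewrite ltnNge sub_xy.
Qed.

Lemma ltD_dcat x y z :
  ltD (canon x) (canon y) -> ltD (canon (dcat z x)) (canon (dcat z y)).
Proof.
case/ltD_mult => e lt_e eq_e; apply: (@mult_ltD _ _ e) => [|e' /eq_e eq_e'].
  by rewrite !mult_dcat ltn_add2l.
by rewrite !mult_dcat eq_e'.
Qed.

(** Classes above [e] contribute equally to both sums and classes below [e] nothing, so the sums
    differ only by the terms of [e]. The terms are moved across to avoid subtraction. *)
Lemma sum_lead x y e (w : data -> nat) :
    (forall e', ltD e e' -> mult x e' = mult y e') ->
    (forall a, ltD (canon a) e -> w (canon a) = 0) ->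
  \sum_(a <- kids x) w (canon a) + mult y e * w e
    = \sum_(a <- kids y) w (canon a) + mult x e * w e.
Proof.
move=> eq_e w0.
have sumE z : \sum_(a <- kids z) w (canon a)
    = \sum_(a <- kids z | ltD e (canon a)) w (canon a) + mult z e * w e.
  rewrite (bigID (fun a => ltD e (canon a))) /=; congr (_ + _).
  rewrite mult_sum big_distrl /= big_mkcond; apply: eq_bigr => a _.
  have [lt_ea | -> | lt_ae] := ltD_total e (canon a).
  - by rewrite lt_ea; case: eqP lt_ea => // ->; rewrite ltD_irr.
  - by rewrite ltD_irr eqxx mul1n.
  - rewrite w0 // if_same; case: eqP lt_ae => // ->; rewrite ltD_irr //.
rewrite !{}sumE addnAC; congr (_ + _ + _).
rewrite -!(big_map canon (ltD e) w) -!(big_filter _ (ltD e)).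
apply: perm_big; apply/allP => f _ /=.
rewrite !count_filter; apply/eqP; case lt_ef: (ltD e f).
  have eqf s : count (predI (pred1 f) (ltD e)) s = count_mem f s.
    by apply: eq_count => g /=; case: eqP => //= ->.
  by rewrite !eqf; apply: eq_e.
have eqf s : count (predI (pred1 f) (ltD e)) s = 0.
  by rewrite (eq_count (a2 := pred0)) ?count_pred0 // => g /=; case: eqP => //= ->.
by rewrite !eqf.
Qed.

Lemma max_mul e s : s != [::] ->
  exists2 q, q \in s & forall b, b \in s -> leD (canon (dmul e b)) (canon (dmul e q)).
Proof.
elim: s => // a [|b s] IHs _.
  by exists a => [|b]; rewrite ?mem_head // inE => /eqP->; apply: leD_refl.
have [//|q qs max_q] := IHs.
have /orP[le_aq | le_qa] := leD_total (canon (dmul e a)) (canon (dmul e q)).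
  by exists q => [|c]; rewrite inE ?qs ?orbT // => /predU1P[-> // | /max_q].
exists a => [|c]; rewrite ?mem_head // inE => /predU1P[-> | /max_q].
  exact: leD_refl.
by move/leD_trans; apply.
Qed.

Lemma ltD_height x y : height x < height y -> ltD (canon x) (canon y).
Proof. by rewrite ltnNge; apply/contra/leD_height. Qed.

(* The largest tree in which the two products differ is [dmul e q], where [e] is
   the largest tree in which [x] and [y] differ, and [q], among the trees of [z],
   maximizes [dmul e q]. *)
Lemma ltD_mul x y z : ltD (canon x) (canon y) -> height y <= height z ->
  ltD (canon (dmul x z)) (canon (dmul y z)).
Proof.
have [n] := ubnP (height y); elim: n x y z => // n IHn x y z ltyn lt_xy le_yz.
have [e lt_e eq_e] := ltD_mult lt_xy.
have /mapP[e0 e0y def_e] : e \in map canon (kids y).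
  by rewrite -has_pred1 has_count (leq_ltn_trans _ lt_e).
have e_id : canon e = e by rewrite def_e canon_id.
have lt_ey : height e < height y by rewrite def_e height_canon height_kid.
(* Some tree [b0] of [z] is at least as high as [e], so [dmul e b0], and hence the maximal
   [dmul e q], is as high as [e]. *)
have [b0 b0z le_eb0] := height_max (leq_trans lt_ey le_yz).
have [|q qz max_q] := @max_mul e (kids z); first by case: (kids z) b0z.
set g := canon (dmul e q) in max_q.
have hg : height e <= height g.
  have := leD_height (max_q _ b0z); rewrite /g height_canon !height_mul.
  by rewrite (minn_idPl le_eb0).
(* If [b] is as high as [e], induction gives [dmul a b] below [dmul e b]; otherwise [dmul a b] is
   lower than [g] in height. *)
have lt_g a b : ltD (canon a) e -> b \in kids z -> ltD (canon (dmul a b)) g.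
  move=> lt_ae bz; case: (leqP (height e) (height b)) => [le_eb | lt_be].
    apply: ltD_le_trans (max_q _ bz); apply: IHn => //; first by lia.
    by rewrite e_id.
  rewrite /g -[canon (dmul e q)]canon_id; apply: ltD_height.
  by apply: leq_trans hg; rewrite height_mul gtn_min lt_be orbT.
pose w f a := \sum_(b <- kids z) (canon (dmul a b) == f).
have wE u f : mult (dmul u z) f = \sum_(a <- kids u) w f (canon a).
  by rewrite mult_mul; apply: eq_bigr => a _; apply: eq_bigr => b _; rewrite canon_mull.
have w0 f a : leD g f -> ltD (canon a) e -> w f (canon a) = 0.
  move=> le_gf lt_ae; rewrite /w big_seq big1 // => b bz; apply/eqP.
  rewrite eqb0 canon_mull; apply: contraTneq (ltD_le_trans (lt_g a b lt_ae bz) le_gf).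
  by move->; rewrite ltD_irr.
have w_lead f : leD g f -> mult (dmul x z) f + mult y e * w f e
    = mult (dmul y z) f + mult x e * w f e.
  by move=> le_gf; rewrite !wE; apply: sum_lead => // a; apply: w0.
(* At [g] the weight of [e] is positive, so the surplus of [e] in [y] shows; above [g] that weight
   vanishes by maximality of [q]. *)
apply: (@mult_ltD _ _ g) => [|f lt_gf].
  have := w_lead g (leD_refl g).
  have: 0 < w g e by rewrite /w (big_rem q qz) /= eqxx.
  nia.
have := w_lead f (ltDW lt_gf); suff -> : w f e = 0 by rewrite !muln0 !addn0.
rewrite /w big_seq big1 // => b /max_q le_bg; apply/eqP; rewrite eqb0.
by apply: contraTneq (leD_lt_trans le_bg lt_gf) => ->; rewrite ltD_irr.
Qed.

(** * Powers *)

(* The power of exponent [j.+1], matching [forest_pow]. *)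
Definition dpow x j := iter j (dmul x) x.

Lemma height_dpow x j : height (dpow x j) = height x.
Proof. by elim: j => //= j IHj; rewrite height_mul IHj minnn. Qed.

Lemma eq_canon_dpow x y j : canon x = canon y -> canon (dpow x j) = canon (dpow y j).
Proof. by move=> eq_xy; elim: j => //= j IHj; apply: eq_canon_mul. Qed.

Lemma canon_mulACA x y z (t : data) :
  canon (dmul (dmul x y) (dmul z t)) = canon (dmul (dmul x z) (dmul y t)).
Proof.
rewrite -!mulA; apply: eq_canon_mul => //; rewrite !mulA.
by apply: eq_canon_mul => //; apply: canon_mulC.
Qed.

Lemma canon_dpow_mul x y j :
  canon (dpow (dmul x y) j) = canon (dmul (dpow x j) (dpow y j)).
Proof.
elim: j => //= j IHj; rewrite -(canon_mulr (dmul x y)) IHj canon_mulr.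
exact: canon_mulACA.
Qed.

(** If [y] is strictly higher, so are its powers. Otherwise both factors of [x * x^j] are replaced
    in turn, passing through [x * y^j], and the height condition of [ltD_mul] holds each time. *)
Lemma ltD_dpow x y j :
  ltD (canon x) (canon y) -> ltD (canon (dpow x j)) (canon (dpow y j)).
Proof.
move=> lt_xy; elim: j => //= j IHj.
case: (leqP (height y) (height x)) => [le_yx | lt_h]; last first.
  by apply: ltD_height; rewrite !height_mul !height_dpow !minnn.
apply: ltD_trans (_ : ltD _ (canon (dmul x (dpow y j)))) _.
  by rewrite canon_mulC (canon_mulC x); apply: ltD_mul; rewrite // height_dpow.
by apply: ltD_mul; rewrite // height_dpow.
Qed.

Lemma leD_dpow x y j :
  leD (canon (dpow x j)) (canon (dpow y j)) -> leD (canon x) (canon y).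
Proof. by apply: contraTT => /(ltD_dpow j). Qed.

Lemma eq_msub x x' y y' :
  canon x = canon x' -> canon y = canon y' -> msub x y -> msub x' y'.
Proof. by move=> /canon_mult eqx /canon_mult eqy sub e; rewrite -eqx -eqy. Qed.

Lemma msub_trans y x z : msub x y -> msub y z -> msub x z.
Proof. by move=> sxy syz e; apply: leq_trans (syz e). Qed.

Lemma msubP x y : msub x y <-> exists z, canon y = canon (dcat x z).
Proof.
split=> [sub_xy | [z /canon_mult eq_y] e]; last by rewrite eq_y mult_dcat leq_addr.
have /count_subseqP[s sub_s prm_s] := sub_xy.
have [u prm_u] := perm_to_subseq sub_s.
exists (dlist u); apply/canonP; rewrite kids_dcat map_cat dlistK.
have -> : map canon u = u.
  rewrite -[RHS]map_id; apply/eq_in_map => a au.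
  have: a \in map canon (kids y) by rewrite (perm_mem prm_u) mem_cat au orbT.
  by case/mapP=> b _ ->; rewrite canon_id.
by rewrite (perm_trans prm_u) // perm_cat2r perm_sym.
Qed.

Lemma msub_mul x y z : msub x y -> msub (dmul z x) (dmul z y).
Proof.
move=> /msubP[u eq_y]; apply/msubP; exists (dmul z u).
by rewrite -canon_mulDr -canon_mulr eq_y canon_mulr.
Qed.

Lemma msub_dpow x y j : msub x y -> msub (dpow x j) (dpow y j).
Proof.
move=> sub_xy; elim: j => //= j IHj.
apply: msub_trans (msub_mul x IHj) _.
by apply: eq_msub (msub_mul (dpow y j) sub_xy); apply: canon_mulC.
Qed.

Lemma msub_cells x y : msub x y -> cells x <= cells y.
Proof.
move=> /msubP[z eq_y]; rewrite -(cells_canon y) eq_y cells_canon.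
by rewrite [cells (dcat _ _)]cellsE kids_dcat big_cat /= -!cellsE leq_addr.
Qed.

(* Multiplying by the one-tree forest [c] truncates all trees at the height of
   [c], which is what makes the forest order compatible with the products. *)
Lemma dpow_overshoot c y z j : (forall q, q \in kids z -> ltD (canon q) (canon c)) ->
  ~ msub (dpow (DCons c y) j) (dpow (dcat y z) j).
Proof.
move=> lt_qc sub; pose c1 := DCons c DNil.
have lt_zc : ltD (canon z) (canon c1).
  apply: (@mult_ltD _ _ (canon c)) => [|e lt_ce].
    rewrite [mult c1 _]/= /mult /= eqxx; rewrite addn0 ltnS.
    rewrite count_map leqNgt -has_count.
    by apply/hasPn => q /lt_qc /=; apply: contraTneq => ->; rewrite ltD_irr.
  rewrite /mult /= addn0; case: eqP => [ce|_]; first by rewrite ce ltD_irr in lt_ce.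
  apply/count_memPn; apply/mapP => -[q /lt_qc lt_q e_q].
  by rewrite e_q in lt_ce; have := ltD_trans lt_ce lt_q; rewrite ltD_irr.
(* Multiplying [z < c1] by [c1] keeps it strict, as the larger side is no higher than the factor;
   the multiple of [y] is then added to both sides. *)
have lt_prod : ltD (canon (dmul c1 (dcat y z))) (canon (dmul c1 (dcat y c1))).
  rewrite !canon_mulDr; apply: ltD_dcat.
  by rewrite canon_mulC; apply: ltD_mul.
(* Both powers split off the power of [c1], and the containment [sub] gives the reverse
   inequality. *)
have /(ltD_dpow j) := lt_prod; rewrite !canon_dpow_mul /ltD => /negP[].
apply: leD_msub; apply: msub_mul; apply: eq_msub sub => //.
apply: eq_canon_dpow; rewrite canon_dcatC; congr canon.
by apply: (can_inj kidsK); rewrite kids_dcat.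
Qed.

(** These are the products whose factors are all the same tree of [x]; so every tree of a root of
    [f] is a root of a tree of [f]. *)
Lemma msub_dpow_diag x j : msub (dlist (map (dpow^~ j) (kids x))) (dpow x j).
Proof.
elim: j => [|j IHj]; first by rewrite map_id kidsK.
apply: msub_trans (msub_mul x IHj) => e.
rewrite mult_mul mult_sum !dlistK big_map big_seq [leqRHS]big_seq.
apply: leq_sum => a ax; rewrite big_map (big_rem a ax) /=; exact: leq_addr.
Qed.

(** * Numbers of vertices at each depth, and sizes of powers *)

Fixpoint level x d : nat :=
  if x is DCons a b then (if d is d'.+1 then level a d' else 1) + level b d else 0.

Lemma levelE x d :
  level x d = \sum_(a <- kids x) (if d is d'.+1 then level a d' else 1).
Proof. by elim: x => [|a _ b IHb] /=; rewrite ?big_nil // big_cons IHb. Qed.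

(** The vertices of a product at depth [d] are all pairs of vertices at depth [d]. *)
Lemma level_mul x y d : level (dmul x y) d = level x d * level y d.
Proof.
elim: d x y => [|d IHd] x y; rewrite !levelE kids_mul big_allpairs_dep big_distrl;
  apply: eq_bigr => a _; rewrite big_distrr; apply: eq_bigr => b _ //.
Qed.

Lemma cells_level x n : height x <= n -> cells x = \sum_(d < n) level x d.
Proof.
elim: x n => [|a IHa b IHb] n /=; first by rewrite big1.
case: n => [|n]; rewrite geq_max // => /andP[le_an le_bn].
rewrite big_split /= big_ord_recl -(IHb n.+1) //.
by rewrite (eq_bigr (fun i : 'I_n => level a i)) // -(IHa n le_an) /=; lia.
Qed.

(** At each depth the count is a power of that of [x]. Hence if the final power has at most [m]
    vertices, so has every intermediate one. *)
Lemma leq_cells_dpow x i j : i <= j -> cells (dpow x i) <= cells (dpow x j).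
Proof.
move=> le_ij; rewrite !(@cells_level _ (height x)) ?height_dpow //.
apply: leq_sum => d _; have levX k : level (dpow x k) d = level x d ^ k.+1.
  by elim: k => //= k IHk; rewrite level_mul IHk -expnS.
rewrite !levX; case: (level x d) => [|l]; first by rewrite !exp0n.
by rewrite leq_pexp2l.
Qed.

(** * The algorithm *)

(** This turns containment of multisets into a test made in one pass. *)
Lemma sorted_subseqP s t : sorted geD s -> sorted geD t ->
  reflect (forall e, count_mem e s <= count_mem e t) (subseq s t).
Proof.
move=> srt_s srt_t; apply: (iffP idP) => [sub_st | /count_subseqP[u sub_u prm_u]].
  by apply/count_subseqP; exists s.
rewrite (sorted_eq geD_trans geD_anti srt_s _ prm_u) //.
exact: subseq_sorted geD_trans _ _ sub_u srt_t.
Qed.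

Lemma msub_subseq x y : canon y = y ->
  reflect (msub x y) (subseq (kids (canon x)) (kids y)).
Proof.
move=> y_id; rewrite -{2}y_id.
have cE z e : count_mem e (kids (canon z)) = mult z e.
  exact/permP/perm_kids_canon.
apply: (iffP (sorted_subseqP (sorted_canon x) (sorted_canon y))) => sub e.
  by rewrite -!cE.
by rewrite !cE.
Qed.

Section Algorithm.
(* [j.+1] is the exponent, and [m] bounds the size of the intermediate products. *)
Variables (j m : nat).

Fixpoint guarded_pow i z w : option data :=
  if i is i'.+1 then
    if cells (dmul z w) <= m then guarded_pow i' z (dmul z w) else None
  else Some w.

Definition fits z f : bool :=
  if guarded_pow j z z is Some w then subseq (kids (canon w)) (kids f) else false.

Fixpoint greedy r y f : data :=
  if r is DCons c r' then
    greedy r' (if fits (DCons c y) f then DCons c y else y) f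
  else y.

(** [greedy] returns some forest even when [f] has no root, hence the final check. It is an equality
    because [f] is meant to be canonical. *)
Definition checked_root f r : option data :=
  let y := greedy r DNil f in
  if guarded_pow j y y is Some w then if canon w == f then Some y else None
  else None.

(** The list R of candidates. A tree [t] has the same code as the forest of its children, so its
    root is that of the forest [t]. *)
Fixpoint tree_roots f : data :=
  if f is DCons t f' then
    if checked_root t (tree_roots t) is Some y then DCons y (tree_roots f')
    else tree_roots f'
  else DNil.

(** * Correctness and completeness of the algorithm *)

Lemma guarded_pow_Some i z w u :
  guarded_pow i z w = Some u -> u = iter i (dmul z) w.
Proof.
elim: i w => [|i IHi] w /=; first by case.
by case: ifP => // _ /IHi->; rewrite -iterSr.
Qed.

Lemma guarded_pow_dpow z : cells (dpow z j) <= m ->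
  guarded_pow j z z = Some (dpow z j).
Proof.
move=> le_m; suff gp i l : l + i = j ->
    guarded_pow i z (dpow z l) = Some (dpow z j) by apply: (gp j 0).
elim: i l => [|i IHi] l /= def_j; first by rewrite -def_j addn0.
rewrite -[dmul z _]/(dpow z l.+1) IHi; last by rewrite addSnnS.
by rewrite (leq_trans (leq_cells_dpow _ _) le_m) // -def_j addnS ltnS leq_addr.
Qed.

Lemma fits_msub z f : canon f = f -> fits z f -> msub (dpow z j) f.
Proof.
rewrite /fits => f_id; case def_w: guarded_pow => [w|] // /(msub_subseq _ f_id).
by rewrite (guarded_pow_Some def_w).
Qed.

Lemma msub_fits z f : canon f = f -> cells f <= m -> msub (dpow z j) f -> fits z f.
Proof.
move=> f_id le_fm sub; rewrite /fits guarded_pow_dpow; first exact/msub_subseq.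
exact: leq_trans (msub_cells sub) le_fm.
Qed.

Lemma checked_root_Some f r y : checked_root f r = Some y -> canon (dpow y j) = f.
Proof.
rewrite /checked_root; case def_w: guarded_pow => [w|] //.
by case: eqP => // eq_f [<-]; rewrite -[RHS]eq_f (guarded_pow_Some def_w).
Qed.

Lemma kids_roots f :
  kids (tree_roots f) = pmap (fun u => checked_root u (tree_roots u)) (kids f).
Proof. by elim: f => //= t _ f <-; case: checked_root. Qed.

(** The powers of the candidates form a subsequence of the sorted list [kids f], and powers reflect
    the order; so R needs no sorting. *)
Lemma sorted_roots f : canon f = f -> sorted geD (map canon (kids (tree_roots f))).
Proof.
move=> f_id; rewrite sorted_map.
have srt_f : sorted geD (kids f) by rewrite -f_id sorted_canon.
have : sorted geD (map (fun y => canon (dpow y j)) (kids (tree_roots f))).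
  apply: subseq_sorted geD_trans _ _ _ srt_f.
  rewrite kids_roots; elim: (kids f) => //= t s IHs.
  case def_y: checked_root => [y|] /=; first by rewrite (checked_root_Some def_y) eqxx.
  exact: subseq_trans IHs (subseq_cons _ _).
by rewrite sorted_map; apply: sub_sorted => y y'; apply: leD_dpow.
Qed.

(** Invariant of the loop: [s] holds the trees of [x] not yet in [y], and they occur in order among
    the remaining candidates [r]. *)
Lemma greedy_complete f x r y s : canon f = f -> cells f <= m ->
    canon (dpow x j) = f -> canon x = canon (dcat y (dlist s)) ->
    sorted geD (map canon (kids r)) -> subseq (map canon s) (map canon (kids r)) ->
  canon (greedy r y f) = canon x.
Proof.
move=> f_id le_fm def_f; elim: r y s => [|c _ r IHr] y s /=.
  move=> -> _ ; case: s => // _; congr canon.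
  by apply: (can_inj kidsK); rewrite kids_dcat cats0.
move=> eq_x srt_r sub_s.
have [take_c | skip_c] := boolP ((s != [::]) && (head DNil (map canon s) == canon c)).
  case: s take_c eq_x sub_s => //= a s /eqP a_c; rewrite a_c eqxx => eq_x sub_s.
  have eq_x' : canon x = canon (dcat (DCons c y) (dlist s)).
    rewrite eq_x; apply/canon_mult => e; rewrite !mult_dcat /mult /= a_c; lia.
  rewrite msub_fits //; first by apply: IHr eq_x' _ sub_s; apply: path_sorted srt_r.
  apply: (@eq_msub (dpow (DCons c y) j) _ (dpow x j)); rewrite ?def_f //.
  by apply: msub_dpow; apply/msubP; exists (dlist s).
have sub_s' : subseq (map canon s) (map canon (kids r)).
  by case: s skip_c sub_s {eq_x} => [|a s] //=; [rewrite sub0seq | move/negPf->].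
(* If some tree of [s] equalled [c], the head of [s], lying between that tree and [c], would equal
   [c] as well. *)
have lt_sc q : q \in s -> ltD (canon q) (canon c).
  move=> qs; rewrite ltD_neqAle; apply/andP; split; last first.
    have /allP := order_path_min geD_trans srt_r; apply.
    by rewrite (mem_subseq sub_s') ?map_f.
  apply: contra skip_c => /eqP q_c.
  case: s qs sub_s sub_s' eq_x => // a s qs _ sub_s' _ /=.
  apply/eqP/geD_anti; rewrite /geD; apply/andP; split; last first.
    have /allP := order_path_min geD_trans srt_r; apply.
    by rewrite (mem_subseq sub_s') ?mem_head.
  have := subseq_sorted geD_trans sub_s' (path_sorted srt_r) => /=.
  move/(order_path_min geD_trans)/allP => le_sa.
  move: qs; rewrite inE => /predU1P[<- | qs]; first by rewrite q_c leD_refl.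
  by rewrite -q_c; apply: le_sa; apply: map_f.
rewrite ifF; first by apply: IHr eq_x _ sub_s'; apply: path_sorted srt_r.
apply/negP => /(fits_msub f_id) sub.
have lt_kc q : q \in kids (dlist s) -> ltD (canon q) (canon c).
  by rewrite dlistK; apply: lt_sc.
apply: (dpow_overshoot (y := y) (j := j) lt_kc).
by apply: eq_msub sub => //; rewrite f_id -def_f; apply: eq_canon_dpow.
Qed.

Lemma checked_root_complete f x : canon f = f -> cells f <= m ->
    canon (dpow x j) = f ->
  exists2 y, checked_root f (tree_roots f) = Some y & canon y = canon x.
Proof.
elim/data_kids_ind: f x => f IHf x f_id le_fm def_f.
have sub_x : subseq (map canon (kids (canon x))) (map canon (kids (tree_roots f))).
  have eq_map : map canon (kids (canon x)) = kids (canon x).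
    by rewrite -[RHS]map_id; apply/eq_in_map => a /canon_kid.
  rewrite eq_map; apply/sorted_subseqP => [||e]; first exact: sorted_canon.
    exact: sorted_roots.
  rewrite (permP (perm_kids_canon x)).
  have [/mapP[a ax def_e] | /count_memPn-> //] := boolP (e \in map canon (kids x)).
  (* By the diagonal, [f] has at least as many copies of the power [t] of [a] as [x] has of [a]; by
     induction each of them yields a candidate equal to [a]. *)
  pose t := canon (dpow a j); apply: leq_trans (_ : count_mem t (kids f) <= _).
    rewrite -def_f (permP (perm_kids_canon _)).
    apply: leq_trans (msub_dpow_diag x j t); rewrite /mult dlistK -!sum1_count.
    rewrite !big_map big_mkcond [leqRHS]big_mkcond; apply: leq_sum => b _ /=.
    case: eqP => // b_e; rewrite ifT //; apply/eqP/eq_canon_dpow.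
    by rewrite b_e.
  (* The induction on the list must remember that its entries are kids of [f], for [IHf] to
     apply. *)
  have : {subset kids f <= kids f} by []; rewrite kids_roots.
  elim: {1 3 4}(kids f) => //= u s IHs sf.
  have {}IHs := IHs (fun v vs => sf v (mem_behead (s := u :: s) vs)).
  have uf := sf u (mem_head _ _); case: eqP => [u_t | _]; last first.
    by case: checked_root => //= y; apply: leq_trans IHs (leq_addl _ _).
  have [||y -> y_a] := IHf u uf a _ _ (esym u_t); rewrite ?u_t ?canon_id //.
    by rewrite -u_t ltnW // (leq_trans (cells_kid uf)).
  by rewrite /= y_a -def_e eqxx.
have eq_y : canon (greedy (tree_roots f) DNil f) = canon x.
  apply: (@greedy_complete f x (tree_roots f) DNil (kids (canon x))) => //.
    rewrite -[LHS]canon_id; congr canon; apply: (can_inj kidsK).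
    by rewrite kids_dcat dlistK.
  exact: sorted_roots.
exists (greedy (tree_roots f) DNil f); rewrite // /checked_root.
have eq_pow : canon (dpow (greedy (tree_roots f) DNil f) j) = f.
  by rewrite -[RHS]def_f; apply: eq_canon_dpow.
by rewrite guarded_pow_dpow ?eq_pow ?eqxx // -cells_canon eq_pow.
Qed.

End Algorithm.

(** * The program and its running time *)

Definition true_code := ECons ENil ENil.

(* Each body is annotated with its arguments, which form its initial environment.
   Below [main_body], the exponent [j.+1] is passed as [unary j], and [u] is the
   size bound [m], passed as [unary m.+1] so that running out of it yields [DNil]. *)
Definition main_body := (* [:: a; k] *)
  ECase (EVar 1) ENil
    (ELet (ECall 3 [:: EVar 2])
      (ELet (ECons ENil (ECall 7 [:: EVar 0; ENil]))
        (ECall 11 [:: EVar 1; ECall 12 [:: EVar 1; EVar 3; EVar 0]; EVar 3; EVar 0]))).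

Definition cmp_body := (* [:: x; y] *)
  ECase (EVar 0)
    (ECase (EVar 1) ENil (ECons ENil ENil))
    (ECase (EVar 3) (ECons true_code ENil)
      (ECase (ECall 1 [:: EVar 2; EVar 0])
        (ECall 1 [:: EVar 3; EVar 1])
        (ECons (EVar 0) (EVar 1)))).

Definition ins_body := (* [:: x; l] *)
  ECase (EVar 1) (ECons (EVar 0) ENil)
    (ECase (ECall 1 [:: EVar 2; EVar 0]) (ECons (EVar 2) (EVar 3))
      (ECase (EVar 0) (ECons (EVar 2) (ECall 2 [:: EVar 4; EVar 3]))
        (ECons (EVar 6) (EVar 7)))).

Definition canon_body := (* [:: x] *)
  ECase (EVar 0) ENil (ECall 2 [:: ECall 3 [:: EVar 0]; ECall 3 [:: EVar 1]]).

Definition row_body := (* [:: x; y; z] *)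
  ECase (EVar 1) (EVar 2)
    (ECons (ECall 5 [:: EVar 2; EVar 0]) (ECall 4 [:: EVar 2; EVar 1; EVar 4])).

(* Testing the emptiness of [y] first makes the running time linear in the size
   of the product. *)
Definition mul_body := (* [:: x; y] *)
  ECase (EVar 0) ENil
    (ECase (EVar 3) ENil
      (ECall 4 [:: EVar 2; EVar 5; ECall 5 [:: EVar 3; EVar 5]])).

Definition consume_body := (* [:: t; u] *)
  ECase (EVar 0) (EVar 1)
    (ECase (EVar 3) ENil (ECall 6 [:: EVar 3; ECall 6 [:: EVar 2; EVar 1]])).

Definition count_body := (* [:: t; u] *)
  ECase (EVar 0) (EVar 1)
    (ECons ENil (ECall 7 [:: EVar 0; ECall 7 [:: EVar 1; EVar 3]])).

Definition pow_body := (* [:: i; z; w; u] *)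
  ECase (EVar 0) (ECons (EVar 2) ENil)
    (ELet (ECall 5 [:: EVar 3; EVar 4])
      (ECase (ECall 6 [:: EVar 0; EVar 6]) ENil
        (ECall 8 [:: EVar 4; EVar 6; EVar 2; EVar 8]))).

Definition sub_body := (* [:: w; f] *)
  ECase (EVar 0) true_code
    (ECase (EVar 3) ENil
      (ECase (ECall 1 [:: EVar 2; EVar 0])
        (ECall 9 [:: EVar 3; EVar 1])
        (ECall 9 [:: EVar 6; EVar 3]))).

Definition greedy_body := (* [:: r; y; f; j; u] *)
  ECase (EVar 0) (EVar 1)
    (ELet (ECons (EVar 0) (EVar 3))
      (ECase (ECall 13 [:: EVar 0; EVar 5; EVar 6; EVar 7])
        (ECall 10 [:: EVar 2; EVar 4; EVar 5; EVar 6; EVar 7])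
        (ECall 10 [:: EVar 4; EVar 2; EVar 7; EVar 8; EVar 9]))).

Definition root_body := (* [:: f; r; j; u] *)
  ELet (ECall 10 [:: EVar 1; ENil; EVar 0; EVar 2; EVar 3])
    (ECase (ECall 8 [:: EVar 3; EVar 0; EVar 0; EVar 4]) ENil
      (ECase (ECall 1 [:: ECall 3 [:: EVar 0]; EVar 3]) (ECons (EVar 2) ENil) ENil)).

Definition roots_body := (* [:: f; j; u] *)
  ECase (EVar 0) ENil
    (ECase (ECall 11 [:: EVar 0; ECall 12 [:: EVar 0; EVar 3; EVar 4]; EVar 3; EVar 4])
      (ECall 12 [:: EVar 1; EVar 3; EVar 4])
      (ECons (EVar 0) (ECall 12 [:: EVar 3; EVar 5; EVar 6]))).

Definition fits_body := (* [:: z; f; j; u] *)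
  ECase (ECall 8 [:: EVar 2; EVar 0; EVar 0; EVar 3]) ENil
    (ECall 9 [:: ECall 3 [:: EVar 0]; EVar 3]).

Definition solver : program :=
  [:: main_body; cmp_body; ins_body; canon_body; row_body; mul_body; consume_body;
      count_body; pow_body; sub_body; greedy_body; root_body; roots_body; fits_body].

(** * Evaluation with upper bounds on time *)

Definition runs env e v b := exists2 n, eval solver env e v n & n <= b.

Definition runss env es vs b := exists2 n, evals solver env es vs n & n <= b.

Definition calls f args v b := runs args (nth ENil solver f) v b.

Lemma runs_le b env e v b' : runs env e v b -> b <= b' -> runs env e v b'.
Proof. by case=> n ev le_nb le_bb; exists n; rewrite ?(leq_trans le_nb). Qed.

Lemma runs_var env i v : nth DNil env i = v -> runs env (EVar i) v 1.
Proof. by move<-; exists 1; first exact: eval_var. Qed.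

Lemma runs_nil env : runs env ENil DNil 1.
Proof. by exists 1; first exact: eval_nil. Qed.

Lemma runs_cons env e1 e2 v1 v2 b1 b2 :
  runs env e1 v1 b1 -> runs env e2 v2 b2 ->
  runs env (ECons e1 e2) (DCons v1 v2) (b1 + b2).+1.
Proof.
by case=> n1 ev1 le1 [n2 ev2 le2]; exists (n1 + n2).+1; [exact: eval_cons | lia].
Qed.

Lemma runs_case env e e0 e1 v w b b' :
  runs env e v b ->
  (if v is DCons x y then runs (x :: y :: env) e1 w b' else runs env e0 w b') ->
  runs env (ECase e e0 e1) w (b + b').+1.
Proof.
case=> n ev le_n; case: v ev => [|x y] ev [n' ev' le_n']; exists (n + n').+1; try lia.
  exact: eval_case_nil ev ev'.
exact: eval_case_cons ev ev'.
Qed.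

Lemma runs_let env e1 e2 v1 v2 b1 b2 :
  runs env e1 v1 b1 -> runs (v1 :: env) e2 v2 b2 ->
  runs env (ELet e1 e2) v2 (b1 + b2).+1.
Proof.
case=> n1 ev1 le1 [n2 ev2 le2]; exists (n1 + n2).+1; last by lia.
exact: eval_let ev1 ev2.
Qed.

Lemma runs_call env f es vs v b1 b2 :
  runss env es vs b1 -> calls f vs v b2 -> runs env (ECall f es) v (b1 + b2).+1.
Proof.
case=> n1 ev1 le1 [n2 ev2 le2]; exists (n1 + n2).+1; last by lia.
exact: eval_call ev1 ev2.
Qed.

Lemma runss_nil env : runss env [::] [::] 0.
Proof. by exists 0; first exact: evals_nil. Qed.

Lemma runss_cons env e es v vs b1 b2 :
  runs env e v b1 -> runss env es vs b2 -> runss env (e :: es) (v :: vs) (b1 + b2).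
Proof.
by case=> n1 ev1 le1 [n2 ev2 le2]; exists (n1 + n2); [exact: evals_cons | lia].
Qed.

Definition option_code (o : option data) : data :=
  if o is Some y then DCons y DNil else DNil.

Definition bool_code (b : bool) : data := if b then DCons DNil DNil else DNil.

(** Symbolic execution of a body: the bound is an existential variable filled by the rules, and
    calls are closed by hypotheses in the context. [call] then leaves one inequality. *)
Ltac run :=
  lazymatch goal with
  | |- runs _ (EVar _) _ _ => eapply runs_var; cbn [nth]; reflexivity
  | |- runs _ ENil _ _ => refine (runs_nil _)
  | |- runs _ (ECons _ _) _ _ => refine (runs_cons _ _); [run | run]
  | |- runs _ (ELet _ _) _ _ => eapply runs_let; [run | run]
  | |- runs _ (ECase _ _ _) _ _ =>
      eapply runs_case; [run | cbn [option_code bool_code]; cbv iota; run]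
  | |- runs _ (ECall _ _) _ _ => eapply runs_call; [run | eassumption]
  | |- runss _ [::] _ _ => apply: runss_nil
  | |- runss _ _ _ _ => eapply runss_cons; [run | run]
  | |- runs ?env ?e ?v ?b => let e' := eval red in e in change (runs env e' v b); run
  | |- _ => idtac
  end.

Ltac call := rewrite /calls /=; eapply runs_le; [run | ].

(** * Running times of the basic functions *)

Definition cmp x y : data :=
  if x == y then DNil
  else if leD x y then DCons DNil DNil else DCons (DCons DNil DNil) DNil.

(** Deciding equality and order in the same pass keeps the comparison linear, whereas [leD] tests
    heads for equality before comparing them. *)
Lemma calls_cmp x y : calls 1 [:: x; y] (cmp x y) (40 * cells y + 20).
Proof.
elim: x y => [|a IHa b IHb] [|c d].
- by call; lia.
- by call; lia.
- by call; lia.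
have eq_ac : (DCons a b == DCons c d) = (a == c) && (b == d).
  by apply/eqP/andP => [[-> ->] | [/eqP-> /eqP->]].
have := IHa c; have := IHb d; rewrite /cmp eq_ac /=.
case: (eqVneq a c) => [-> | _] Hb; first by move=> Ha; call; lia.
by rewrite /=; case: ifP => _ Ha; call; lia.
Qed.

Lemma calls_ins x l : calls 2 [:: x; l] (insD x l) (100 * cells l + 50).
Proof.
elim: l => [|y _ l IHl]; first by call; lia.
have := calls_cmp x y; rewrite /cmp /=.
case: eqVneq => [-> | neq_xy]; first by rewrite leD_refl => H; call; lia.
case: ifP => [le_xy | /negbT lt_yx] H.
  have -> : leD y x = false.
    by apply: contra_neqF neq_xy => le_yx; apply: leD_anti; rewrite le_xy.
  by call; lia.
by rewrite (ltDW lt_yx); call; lia.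
Qed.

Lemma calls_canon x :
  calls 3 [:: x] (canon x) (100 * (cells x * cells x) + 200 * cells x + 10).
Proof.
elim: x => [|a IHa b IHb]; first by call; lia.
have := calls_ins (canon a) (canon b); rewrite cells_canon => H.
by call; nia.
Qed.

Lemma cells_row x y z : cells (drow x y z) =
  \sum_(b <- kids y) cells (dmul x b) + size (kids y) + cells z.
Proof. by elim: y => [|b _ y IHy] /=; rewrite ?big_nil // big_cons IHy; lia. Qed.

(** For nonempty [y] each row adds at least one cell to the product, which pays for the overhead of
    the row. *)
Lemma calls_mul x y : calls 5 [:: x; y] (dmul x y) (100 * cells (dmul x y) + 20).
Proof.
elim: x y => [|a IHa x IHx] [|b y].
- by call; lia.
- by call; lia.
- by rewrite mulD0; call; lia.
have calls_row z u : calls 4 [:: a; z; u] (drow a z u)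
    (100 * (\sum_(b <- kids z) cells (dmul a b)) + 40 * size (kids z) + 5).
  elim: z => [|c _ z IHz]; first by call; rewrite /=; lia.
  have Hc := IHa c; rewrite [drow _ _ _]/=; call; rewrite /= big_cons; lia.
have Hx := IHx (DCons b y); have Hr := calls_row (DCons b y) (dmul x (DCons b y)).
move: Hx Hr (cells_row a (DCons b y) (dmul x (DCons b y))); rewrite mul_cons.
move: (dmul x _) => w; move: (drow _ _ _) => w' Hx Hr def_w; call.
rewrite def_w /=; lia.
Qed.

Lemma calls_consume x n :
  calls 6 [:: x; unary n] (unary (n - cells x)) (40 * cells x + 20).
Proof.
elim: x n => [|a IHa b IHb] n; first by rewrite subn0; call; lia.
case: n => [|n]; first by rewrite sub0n -[unary 0]/DNil; call; lia.
rewrite [cells _]/= subSS -[unary n.+1]/(DCons DNil (unary n)).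
have Ha := IHa n; have := IHb (n - cells a); rewrite -subnDA => Hb.
by call; rewrite /=; lia.
Qed.

Lemma calls_count x n :
  calls 7 [:: x; unary n] (unary (cells x + n)) (40 * cells x + 20).
Proof.
elim: x n => [|a IHa b IHb] n; first by call; lia.
have Hb := IHb n; have := IHa (cells b + n); rewrite addnA => Ha.
rewrite [cells _]/= addSn -[unary _.+1]/(DCons DNil (unary (cells a + cells b + n))).
by call; rewrite /=; lia.
Qed.

Lemma calls_sub x y :
  calls 9 [:: x; y] (bool_code (subseq (kids x) (kids y))) (100 * cells y + 50).
Proof.
elim: y x => [|b _ y IHy] [|a x]; try by call; lia.
have := calls_cmp a b; rewrite /cmp /=; have := IHy x; have := IHy (DCons a x).
case: eqVneq => [_ | _] H1 H2; first by move=> H; call; lia.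
by case: ifP => _ H; call; lia.
Qed.

Section Cost.
Variables j m : nat.
Hypothesis le_jm : j <= m.
Let M := m.+1.

(** A round that passes the test yields at most [m] cells and costs O(M). Only the product that
    fails is larger, with at most [4 * (M * M)] cells; this is the quadratic term. *)
Lemma calls_pow i z w : cells z <= 2 * M -> cells w <= 2 * M ->
  calls 8 [:: unary i; z; w; unary m.+1] (option_code (guarded_pow m i z w))
    (600 * (M * M) + 100 + i * (200 * M)).
Proof.
move=> le_z; elim: i w => [|i IHi] w le_w.
  by rewrite -[unary 0]/DNil; call; lia.
rewrite -[unary i.+1]/(DCons DNil (unary i)).
have Hm := calls_mul z w; have Hc := calls_consume (dmul z w) m.+1.
have le_zw : cells (dmul z w) <= 4 * (M * M).
  by apply: leq_trans (cells_mul z w) _; nia.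
move: Hc; rewrite [guarded_pow _ _ _ _]/=; case: (leqP (cells _) m) => [le_m | gt_m].
  rewrite subSn // -[unary (m - cells (dmul z w)).+1]/(DCons DNil _) => Hc.
  by have := IHi (dmul z w); move=> /(_ ltac:(lia)) Hi; call; rewrite /M; nia.
have -> : m.+1 - cells (dmul z w) = 0 by lia.
by rewrite -[unary 0]/DNil => Hc; call; rewrite /M in le_zw *; nia.
Qed.

Lemma cells_guarded_pow i z w u : cells w <= 2 * M ->
  guarded_pow m i z w = Some u -> cells u <= 2 * M.
Proof.
elim: i w => [|i IHi] w /= le_w; first by case=> <-.
by case: ifP => // le_m; apply: IHi; rewrite /M; lia.
Qed.

(** Since [j <= m], the [j] rounds of cost O(M) stay within O(M^2). *)
Lemma calls_pow_diag z : cells z <= 2 * M ->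
  calls 8 [:: unary j; z; z; unary m.+1] (option_code (guarded_pow m j z z))
    (900 * (M * M)).
Proof.
by move=> le_z; apply: runs_le (calls_pow j le_z le_z) _; rewrite /M; nia.
Qed.

Lemma calls_fits z f : cells z <= 2 * M -> cells f <= m ->
  calls 13 [:: z; f; unary j; unary m.+1] (bool_code (fits j m z f)) (2100 * (M * M)).
Proof.
move=> le_z le_f; have := calls_pow_diag le_z; rewrite /fits.
case def_w: guarded_pow => [w|] Hp; last by call; rewrite /M; nia.
have le_w := cells_guarded_pow le_z def_w.
have Hc := calls_canon w; have Hs := calls_sub (canon w) f.
by call; rewrite /M in le_w *; nia.
Qed.

Lemma fits_cells z f : canon f = f -> fits j m z f -> cells z <= cells f.
Proof.
move=> f_id /(fits_msub f_id)/msub_cells; apply: leq_trans.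
exact: (@leq_cells_dpow z 0).
Qed.

Lemma greedy_cells r y f : canon f = f -> cells y <= cells f ->
  cells (greedy j m r y f) <= cells f.
Proof.
move=> f_id; elim: r y => //= c _ r IHr y le_y; apply: IHr.
by case: ifP => // /(fits_cells f_id).
Qed.

Lemma calls_greedy r y f : canon f = f -> cells f <= m -> cells y <= cells f ->
    (forall c, c \in kids r -> cells c <= m) ->
  calls 10 [:: r; y; f; unary j; unary m.+1] (greedy j m r y f)
    (2200 * (M * M) * size (kids r) + 10).
Proof.
move=> f_id le_f; elim: r y => [|c _ r IHr] y le_y le_r; first by call; lia.
(* The factor 2 in the size bounds comes from here: [c] and [y] may each have [m] cells. *)
have le_cy : cells (DCons c y) <= 2 * M.
  by have := le_r c (mem_head _ _); rewrite /= /M; lia.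
have {}le_r a : a \in kids r -> cells a <= m.
  by move=> ar; apply: le_r; rewrite inE ar orbT.
have := calls_fits le_cy le_f; rewrite [greedy _ _ _ _ _]/=.
case fits_cy: fits => Hf.
  have H := IHr _ (fits_cells f_id fits_cy) le_r.
  by call; rewrite /M; nia.
by have H := IHr _ le_y le_r; call; rewrite /M; nia.
Qed.

Lemma calls_root f r : canon f = f -> cells f <= m ->
    (forall c, c \in kids r -> cells c <= m) ->
  calls 11 [:: f; r; unary j; unary m.+1] (option_code (checked_root j m f r))
    (2200 * (M * M) * (size (kids r)).+1).
Proof.
move=> f_id le_f le_r; have Hg := calls_greedy (y := DNil) f_id le_f (leq0n _) le_r.
have := @greedy_cells r DNil f f_id (leq0n _).
rewrite /checked_root; move: (greedy _ _ _ _ _) Hg => y Hg le_y.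
have le_y' : cells y <= 2 * M by rewrite /M; lia.
have := calls_pow_diag le_y'; case def_w: guarded_pow => [w|] Hp; last first.
  by call; rewrite /M; nia.
have le_w := cells_guarded_pow le_y' def_w.
have Hc := calls_canon w; have := calls_cmp (canon w) f.
rewrite /cmp; case: eqP => _ Hf.
  by call; rewrite /M in le_w *; nia.
by case: ifP Hf => _ Hf; call; rewrite /M in le_w *; nia.
Qed.

Lemma checked_root_cells f r y : checked_root j m f r = Some y -> cells y <= cells f.
Proof.
move/checked_root_Some => <-; rewrite cells_canon.
exact: (@leq_cells_dpow y 0).
Qed.

Lemma roots_cells f c : c \in kids (tree_roots j m f) -> cells c <= cells f.
Proof.
rewrite kids_roots mem_pmap => /mapP[t tf /esym/checked_root_cells le_c].
exact: leq_trans le_c (ltnW (cells_kid tf)).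
Qed.

Lemma size_roots f : size (kids (tree_roots j m f)) <= size (kids f).
Proof. by rewrite kids_roots size_pmap count_size. Qed.

(** With [B = 2200 * (M * M)], a kid [t] costs [B] times three times the cells of its kids plus
    twice their number for the recursion, and [B] times their number plus one for the root:
    [B * (3 * cells t + 1)] in all. One more [B] covers the overhead. *)
Lemma calls_roots f : canon f = f -> cells f <= m ->
  calls 12 [:: f; unary j; unary m.+1] (tree_roots j m f)
    (2200 * (M * M) * (3 * (\sum_(t <- kids f) cells t) + 2 * size (kids f)) + 10).
Proof.
move=> f_id; have id_kids t : t \in kids f -> canon t = t.
  by move=> tf; rewrite (@canon_kid _ f) // f_id.
elim: f id_kids {f_id} => [|t IHt f IHf] id_kids /= le_f; first by call; lia.
have t_id := id_kids t (mem_head _ _).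
have {}IHf := IHf (fun u uf => id_kids u (mem_behead (s := t :: kids f) uf)).
have Hf := IHf ltac:(lia).
have id_t u : u \in kids t -> canon u = u.
  by move=> ut; apply: (@canon_kid u t); rewrite t_id.
have Ht := IHt id_t ltac:(lia).
have le_r c : c \in kids (tree_roots j m t) -> cells c <= m.
  by move/roots_cells => le_c; lia.
have := calls_root t_id ltac:(lia) le_r.
have := size_roots t; rewrite big_cons.
have -> : cells t = \sum_(u <- kids t) cells u + size (kids t).
  by rewrite cellsE -sum1_size -big_split; apply: eq_bigr => u _; rewrite /= addn1.
set B := 2200 * (M * M) in Hf Ht *; have ltB : 50 < B by rewrite /B /M; nia.
by case: checked_root => [y|] le_s Hr; call; nia.
Qed.

End Cost.

Lemma calls_main j a : j <= cells a ->
  calls 0 [:: a; unary j.+1]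
    (option_code (checked_root j (cells a) (canon a) (tree_roots j (cells a) (canon a))))
    (100 * (100 * ((cells a).+1 * (cells a).+1 * (cells a).+1))).
Proof.
move=> le_j; set m := cells a in le_j *.
have f_id := canon_id a; have le_f : cells (canon a) <= m by rewrite cells_canon.
have Hc := calls_canon a; have := calls_count (canon a) 0; rewrite addn0 cells_canon.
rewrite -[unary 0]/DNil -/m => Hn.
have Hs := calls_roots le_j f_id le_f.
have le_r c : c \in kids (tree_roots j m (canon a)) -> cells c <= m.
  by move/roots_cells/leq_trans; apply.
have Hr := calls_root le_j f_id le_f le_r.
rewrite -[unary j.+1]/(DCons DNil (unary j)).
have le_rs := size_roots j m (canon a).
have sum_m : \sum_(t <- kids (canon a)) cells t + size (kids (canon a)) = m.
  rewrite /m -cells_canon [RHS]cellsE -sum1_size -big_split /=.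
  by apply: eq_bigr => u _; rewrite addn1.
call; set B := 2200 * (m.+1 * m.+1).
set T := m.+1 * m.+1 * m.+1.
(* Three of the terms [B * m.+1] pay for the candidates and one for the root of the whole forest;
   [1200 * T] pays for sorting and counting. *)
have def_T : 100 * (100 * T) = 4 * (B * m.+1) + 1200 * T by rewrite /B /T; lia.
have le_T : m * m + m + 1 <= T by rewrite /T; nia.
have le1 : B * (3 * (\sum_(t <- kids (canon a)) cells t) + 2 * size (kids (canon a)))
    <= 3 * (B * m.+1).
  by rewrite mulnCA leq_mul2l; apply/orP; right; lia.
have le2 : B * (size (kids (tree_roots j m (canon a)))).+1 <= B * m.+1.
  by rewrite leq_mul2l; apply/orP; right; lia.
move: (B * _) (B * _) (B * _) T le1 le2 le_T def_T => *; lia.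
Qed.

(** * Codes of trees *)

Section Forall2.
Variables T T' : eqType.
Implicit Types (R : T -> data -> Prop) (us : seq T).

Lemma Forall2_mem R us s u : List.Forall2 R us s -> u \in us ->
  exists2 c, c \in s & R u c.
Proof.
elim=> // v c vs cs Rvc _ IH; rewrite inE => /predU1P[-> | /IH[d ds Rud]].
  by exists c; rewrite ?mem_head.
by exists d; rewrite // inE ds orbT.
Qed.

Lemma Forall2_impl R R' us s : List.Forall2 R us s ->
  (forall u c, u \in us -> c \in s -> R u c -> R' u c) -> List.Forall2 R' us s.
Proof.
elim=> [|v c vs cs Rvc _ IH] RR'; constructor; first by apply: RR' => //; apply: mem_head.
by apply: IH => u d uvs dcs; apply: RR'; rewrite inE ?uvs ?dcs orbT.
Qed.

Lemma Forall2_map_eq R us s (f : T -> T') g : List.Forall2 R us s ->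
  (forall u c, u \in us -> c \in s -> R u c -> f u = g c) -> map f us = map g s.
Proof.
move=> Rus fg; have: List.Forall2 (fun u c => f u = g c) us s.
  exact: Forall2_impl Rus fg.
by elim=> //= u c us' cs -> _ ->.
Qed.

Lemma Forall2_map (R : T' -> data -> Prop) (f : T -> T') us s :
  List.Forall2 R (map f us) s <-> List.Forall2 (fun u => R (f u)) us s.
Proof.
elim: us s => [|u us IHus] [|c s] /=; split=> H; inversion H; subst; constructor => //;
  exact/IHus.
Qed.

Lemma Forall2_cat R us vs s s' : List.Forall2 R us s -> List.Forall2 R vs s' ->
  List.Forall2 R (us ++ vs) (s ++ s').
Proof. by elim=> //= u c us' cs Ruc _ IH /IH; constructor. Qed.

End Forall2.

Lemma Forall2_allpairs (T T' : eqType) (R : T -> data -> Prop) (R' : T' -> data -> Prop)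
    (Q : T * T' -> data -> Prop) f us vs s s' :
  List.Forall2 R us s -> List.Forall2 R' vs s' ->
  (forall u c v d, c \in s -> R u c -> R' v d -> Q (u, v) (f c d)) ->
  List.Forall2 Q [seq (u, v) | u <- us, v <- vs] [seq f c d | c <- s, d <- s'].
Proof.
move=> Rus Rvs; elim: Rus => //= u c us' cs Ruc _ IH RQ; apply: Forall2_cat; last first.
  by apply: IH => w b v d bcs; apply: RQ; rewrite inE bcs orbT.
elim: Rvs {IH} => //= v d vs' ds Rvd _; constructor=> //.
by apply: RQ; rewrite ?mem_head.
Qed.

Lemma vertex_codeP (t : rooted_tree) (v : vertex t) x :
  vertex_code v x <-> exists us, [/\ uniq us, forall u, (u \in us) = arc u v
    & List.Forall2 (@vertex_code t) us (kids x)].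
Proof.
split=> [[{}v us cs us_uniq usE codes] | [us [us_uniq usE codes]]].
  by exists us; rewrite dlistK.
by rewrite -[x]kidsK; apply: VertexCode codes.
Qed.

(** * Canonical codes of vertices *)

Section TreeCode.
Variable t : rooted_tree.
Implicit Types u v w : vertex t.

Definition children v := enum [pred u | arc u v].

Lemma mem_children u v : (u \in children v) = arc u v.
Proof. by rewrite mem_enum. Qed.

(* The canonical code of the vertex [v], provided [n] exceeds its height. *)
Fixpoint vcode n v : data :=
  if n is n'.+1 then canon (dlist (map (vcode n') (children v))) else DNil.

Lemma canon_vcode n v : canon (vcode n v) = vcode n v.
Proof. by case: n => //= n; rewrite canon_id. Qed.

(** All codes of a vertex, whatever the order of the children, thus have the same canonical form. *)
Lemma vertex_code_vcode n v x : vertex_code v x -> cells x < n -> vcode n v = canon x.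
Proof.
elim: n v x => // n IHn v x /vertex_codeP[us [us_uniq usE codes]] lt_xn /=.
apply/canonP; rewrite dlistK -map_comp.
have prm : perm_eq (children v) us.
  by apply: uniq_perm; rewrite ?enum_uniq // => u; rewrite mem_children usE.
apply: perm_trans (perm_map _ prm) _.
rewrite (Forall2_map_eq codes (g := canon)) // => u c _ cx uc /=.
by rewrite canon_vcode; apply: IHn => //; have := cells_kid cx; lia.
Qed.

Lemma tree_code_vertex x v : tree_code t x ->
  exists2 y, vertex_code v y & cells y <= cells x.
Proof.
move=> tx; move: {2}(depth v) (erefl (depth v)) => n; elim: n v => [|n IHn] v.
  by move/eqP; rewrite depth_eq0 => /eqP->; exists x.
move/eqP/depthS => [w vw dw]; have [y wy le_yx] := IHn w dw.
have /vertex_codeP[us [_ usE codes]] := wy.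
have [|c cy vc] := Forall2_mem codes (u := v); first by rewrite usE.
by exists c => //; have := cells_kid cy; lia.
Qed.

(** Beyond [cells x] the value no longer depends on [n], so the recursion equation holds with the
    same [n] on both sides. *)
Lemma vcodeE x v n : tree_code t x -> cells x < n ->
  vcode n v = canon (dlist (map (vcode n) (children v))).
Proof.
move=> tx lt_xn; have [y vy le_yx] := tree_code_vertex v tx.
rewrite -[RHS]/(vcode n.+1 v) !(vertex_code_vcode vy) //; lia.
Qed.

End TreeCode.

Lemma vcode_iso (t1 t2 : rooted_tree) (f : vertex t1 -> vertex t2) n v :
  bijective f -> (forall u w, arc (f u) (f w) = arc u w) -> vcode n (f v) = vcode n v.
Proof.
move=> bij_f arc_f; elim: n v => //= n IHn v; apply/canonP; rewrite !dlistK.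
have prm : perm_eq (children (f v)) (map f (children v)).
  have [g gK fK] := bij_f; apply: uniq_perm => [||u]; first exact: enum_uniq.
    by rewrite map_inj_uniq ?enum_uniq //; apply: bij_inj.
  by rewrite -[u]fK mem_map ?mem_children ?arc_f //; apply: bij_inj.
rewrite -!map_comp (perm_trans (perm_map _ prm)) // -map_comp.
by under eq_map => u /= do rewrite IHn.
Qed.

Lemma tree_code_iso (t1 t2 : rooted_tree) x1 x2 :
  tree_code t1 x1 -> tree_code t2 x2 -> tree_iso t1 t2 -> canon x1 = canon x2.
Proof.
move=> c1 c2 [f [bij_f f_root arc_f]]; pose n := (cells x1 + cells x2).+1.
have lt1 : cells x1 < n by rewrite /n; lia.
have lt2 : cells x2 < n by rewrite /n; lia.
rewrite -(vertex_code_vcode c1 lt1) -(vertex_code_vcode c2 lt2) -f_root.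
by rewrite (vcode_iso _ _ bij_f).
Qed.

(** * Isomorphisms from equal canonical codes *)

Section Embedding.
Variables (t1 t2 : rooted_tree) (n : nat).

Definition sorted_children (t : rooted_tree) (v : vertex t) :=
  sort (relpre (vcode n) geD) (children v).

Lemma index_sorted_children (t : rooted_tree) (u v : vertex t) :
  (index u (sorted_children v) < size (sorted_children v)) = arc u v.
Proof. by rewrite index_mem mem_sort mem_children. Qed.

Definition parent (t : rooted_tree) (v : vertex t) : vertex t :=
  odflt root [pick w | arc v w].

Lemma parentE (t : rooted_tree) (v w : vertex t) : arc v w -> parent v = w.
Proof.
move=> vw; rewrite /parent; case: pickP => [w' vw' | /(_ w)]; last by rewrite vw.
exact: arc_functional vw' vw.
Qed.

Fixpoint embed_rec k (v : vertex t1) : vertex t2 :=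
  if k is k'.+1 then
    nth root (sorted_children (embed_rec k' (parent v)))
      (index v (sorted_children (parent v)))
  else root.

(* A vertex is mapped to the child of equal rank, in the order of the codes, of
   the image of its parent. *)
Definition embed v := embed_rec (depth v) v.

Hypothesis vcode1E : forall v : vertex t1,
  vcode n v = canon (dlist (map (vcode n) (children v))).
Hypothesis vcode2E : forall v : vertex t2,
  vcode n v = canon (dlist (map (vcode n) (children v))).
Hypothesis eq_root : vcode n (root : vertex t1) = vcode n (root : vertex t2).

Lemma map_sorted_children (t : rooted_tree) (v : vertex t) :
  vcode n v = canon (dlist (map (vcode n) (children v))) ->
  map (vcode n) (sorted_children v) = kids (vcode n v).
Proof.
move=> ->; rewrite kids_canon dlistK -sort_map; congr (sort _ _).
by rewrite -map_comp; apply: eq_map => u; rewrite /= canon_vcode.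
Qed.

Lemma embed_root : embed root = root.
Proof. by rewrite /embed depth_root. Qed.

Lemma embed_arc u v : arc u v ->
  embed u = nth root (sorted_children (embed v)) (index u (sorted_children v)).
Proof.
move=> uv; rewrite /embed; have /eqP-> : depth u == (depth v).+1.
  by apply/depthS; exists v.
by rewrite /= (parentE uv).
Qed.

(** If a parent and its image have the same code, their sorted children have the same list of codes,
    so children of equal rank have equal codes. *)
Lemma vcode_embed v : vcode n (embed v) = vcode n v.
Proof.
move: {2}(depth v) (erefl (depth v)) => k; elim: k v => [|k IHk] v.
  by move/eqP; rewrite depth_eq0 => /eqP->; rewrite embed_root.
move/eqP/depthS => [w vw dw]; rewrite (embed_arc vw).
have eq_ch : map (vcode n) (sorted_children (embed w)) = map (vcode n) (sorted_children w).
  by rewrite (map_sorted_children (vcode2E _)) (map_sorted_children (vcode1E _)) IHk.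
have lt_v : index v (sorted_children w) < size (sorted_children w).
  by rewrite index_sorted_children.
rewrite -(nth_map _ DNil) ?eq_ch; last by rewrite -(size_map (vcode n)) eq_ch size_map.
by rewrite (nth_map root) // nth_index // -index_mem.
Qed.

Lemma size_embed v :
  size (sorted_children (embed v)) = size (sorted_children v).
Proof.
rewrite -(size_map (vcode n)) -[RHS](size_map (vcode n)).
by rewrite (map_sorted_children (vcode2E _)) (map_sorted_children (vcode1E _)) vcode_embed.
Qed.

Lemma embed_homo u v : arc u v -> arc (embed u) (embed v).
Proof.
move=> uv; rewrite -mem_children -(mem_sort (relpre (vcode n) geD)) (embed_arc uv).
by rewrite mem_nth // size_embed index_sorted_children.
Qed.

Lemma depth_embed v : depth (embed v) = depth v.
Proof.
move: {2 3}(depth v) (erefl (depth v)) => k; elim: k v => [|k IHk] v /eqP.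
  by rewrite depth_eq0 => /eqP->; rewrite embed_root depth_root.
move/depthS => [w vw dw]; apply/eqP/depthS; exists (embed w); last exact: IHk.
exact: embed_homo.
Qed.

(** Vertices with the same image have the same depth; by induction they have the same parent, and
    then the same rank under it. *)
Lemma embed_inj : injective embed.
Proof.
move=> v v'; move: {2}(depth v) (erefl (depth v)) => k.
elim: k v v' => [|k IHk] v v' dv eq_vv'; have := depth_embed v'.
  rewrite -eq_vv' depth_embed => /esym dv'.
  rewrite dv in dv'; move/eqP: dv; move/eqP: dv'.
  by rewrite !depth_eq0 => /eqP-> /eqP->.
rewrite -eq_vv' depth_embed dv => /esym/eqP/depthS[w' vw' dw'].
move/eqP/depthS: dv => [w vw dw].
have eq_ww' : w = w'.
  apply: IHk => //; apply: arc_functional (embed_homo vw) _.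
  by rewrite eq_vv' embed_homo.
have := eq_vv'; rewrite (embed_arc vw) (embed_arc vw') -eq_ww' => /eqP.
rewrite nth_uniq ?size_embed ?index_sorted_children //; last 2 first.
- by rewrite eq_ww'.
- by rewrite sort_uniq enum_uniq.
have cv : v \in sorted_children w by rewrite -index_mem index_sorted_children.
move/eqP => eq_ix; rewrite -(nth_index root cv) eq_ix nth_index //.
by rewrite -index_mem index_sorted_children eq_ww'.
Qed.

End Embedding.

(** The embedding is bijective because there is also an injection in the other direction and the
    trees are finite. *)
Lemma tree_code_inj (t1 t2 : rooted_tree) x1 x2 :
  tree_code t1 x1 -> tree_code t2 x2 -> canon x1 = canon x2 -> tree_iso t1 t2.
Proof.
move=> c1 c2 eq_c; pose n := (cells x1 + cells x2).+1.
have lt1 : cells x1 < n by rewrite /n; lia.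
have lt2 : cells x2 < n by rewrite /n; lia.
have eq_root : vcode n (root : vertex t1) = vcode n (root : vertex t2).
  by rewrite (vertex_code_vcode c1 lt1) (vertex_code_vcode c2 lt2).
have E1 v := vcodeE v c1 lt1; have E2 v := vcodeE v c2 lt2.
pose f : vertex t1 -> vertex t2 := @embed t1 t2 n.
have f_inj : injective f by apply: embed_inj.
have f_arc v w : arc v w -> arc (f v) (f w) by apply: embed_homo.
exists f; split; last first.
(* Arcs are reflected because [v] is not the root, and the image of its parent must be [f w] by
   functionality. *)
- move=> v w; apply/idP/idP => [fvw | /f_arc//].
  case dv: (depth v) => [|d].
    move/eqP: dv; rewrite depth_eq0 => /eqP v0.
    by rewrite v0 /f embed_root (negPf (root_sink _)) in fvw.
  have /depthS[p vp _] : depth v == d.+1 by rewrite dv.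
  by have := arc_functional fvw (f_arc _ _ vp) => /f_inj->.
- exact: embed_root.
apply: inj_card_bij f_inj _; apply: (@leq_card _ _ (@embed t2 t1 n)).
by apply: embed_inj.
Qed.

(* [ta] becomes a child subtree of the root of [tb], as in [DCons a b]. *)
Section Graft.
Variables ta tb : rooted_tree.

Definition graft_arc : rel (vertex ta + vertex tb) := fun v w =>
  match v, w with
  | inl v, inl w => arc v w
  | inl v, inr w => (v == root) && (w == root)
  | inr v, inr w => arc v w
  | inr _, inl _ => false
  end.

Lemma graft_root_sink v : ~~ graft_arc (inr root) v.
Proof. by case: v => //= v; apply: root_sink. Qed.

Lemma graft_functional v w w' : graft_arc v w -> graft_arc v w' -> w = w'.
Proof.
case: v w w' => [v|v] [w|w] [w'|w'] //=.
- by move=> vw vw'; rewrite (arc_functional vw vw').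
- by move=> vw /andP[/eqP v0 _]; rewrite v0 (negPf (root_sink w)) in vw.
- by move=> /andP[/eqP-> _]; rewrite (negPf (root_sink _)).
- by move=> /andP[_ /eqP->] /andP[_ /eqP->].
- by move=> vw vw'; rewrite (arc_functional vw vw').
Qed.

Lemma graft_reachable v : connect graft_arc v (inr root).
Proof.
have reach (t : rooted_tree) (h : vertex t -> vertex ta + vertex tb) (w : vertex t) :
    (forall u u', arc u u' -> graft_arc (h u) (h u')) ->
    connect graft_arc (h w) (h root).
  move=> arc_h; have /connectP[p pp lp] := root_reachable w.
  apply/connectP; exists (map h p); last by rewrite last_map -lp.
  exact: homo_path pp.
case: v => v; last exact: reach.
apply: connect_trans (reach ta inl v _) (connect1 _) => //=; by rewrite !eqxx.
Qed.

Definition graft : rooted_tree :=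
  RootedTree graft_root_sink graft_functional graft_reachable.

Lemma vertex_code_graft_l v x : vertex_code v x -> @vertex_code graft (inl v) x.
Proof.
elim/data_kids_ind: x v => x IHx v /vertex_codeP[us [us_uniq usE codes]].
apply/vertex_codeP; exists (map inl us); split.
- by rewrite map_inj_uniq // => u u' [].
- case=> u; first by rewrite mem_map ?usE // => w w' [].
  by apply/mapP => -[].
by apply/Forall2_map; apply: Forall2_impl codes _ => u c _ cx; apply: IHx.
Qed.

Lemma vertex_code_graft_r v x : v != root ->
  vertex_code v x -> @vertex_code graft (inr v) x.
Proof.
elim/data_kids_ind: x v => x IHx v v_neq0 /vertex_codeP[us [us_uniq usE codes]].
apply/vertex_codeP; exists (map inr us); split.
- by rewrite map_inj_uniq // => u u' [].
- case=> u; last by rewrite mem_map ?usE // => w w' [].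
  by rewrite /= (negPf v_neq0) andbF; apply/mapP => -[].
apply/Forall2_map; apply: Forall2_impl codes _ => u c uus cx; apply: IHx => //.
by apply: contraTneq uus => ->; rewrite usE root_sink.
Qed.

Lemma tree_code_graft a b : tree_code ta a -> tree_code tb b ->
  tree_code graft (DCons a b).
Proof.
move=> ca /vertex_codeP[us [us_uniq usE codes]].
apply/vertex_codeP; exists (inl root :: map inr us); split.
- rewrite /= map_inj_uniq ?us_uniq ?andbT; last by move=> u u' [].
  by apply/mapP => -[].
- case=> u; rewrite inE /=.
    rewrite eqxx andbT orbC; case: (boolP (inl u \in _)) => [/mapP[]//|_].
    by apply/eqP/eqP => [[->]|->].
  by rewrite mem_map ?usE // => w w' [].
constructor; first exact: vertex_code_graft_l.
apply/Forall2_map; apply: Forall2_impl codes _ => u c uus cx; apply: vertex_code_graft_r.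
by apply: contraTneq uus => ->; rewrite usE root_sink.
Qed.

End Graft.

Definition unit_arc : rel unit := fun _ _ => false.

Lemma unit_root_sink v : ~~ unit_arc tt v. Proof. by []. Qed.
Lemma unit_functional v w w' : unit_arc v w -> unit_arc v w' -> w = w'.
Proof. by []. Qed.
Lemma unit_reachable v : connect unit_arc v tt.
Proof. by case: v; apply: connect0. Qed.

Fixpoint tree_of_data x : rooted_tree :=
  if x is DCons a b then graft (tree_of_data a) (tree_of_data b)
  else RootedTree unit_root_sink unit_functional unit_reachable.

Lemma tree_of_dataP x : tree_code (tree_of_data x) x.
Proof.
elim: x => [|a IHa b IHb] /=; last exact: tree_code_graft.
by apply/vertex_codeP; exists [::]; split=> //; constructor.
Qed.

Lemma card_tree_of_data x : #|vertex (tree_of_data x)| = (cells x).+1.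
Proof. by elim: x => [|a IHa b IHb] /=; rewrite ?card_unit // card_sum IHa IHb; lia. Qed.

(** The vertices are counted on the isomorphic tree [tree_of_data x]. *)
Lemma card_tree_code t x : tree_code t x -> #|vertex t| = (cells x).+1.
Proof.
move=> tx; have [f [bij_f _ _]] := tree_code_inj tx (tree_of_dataP x) erefl.
by rewrite (bij_eq_card bij_f) card_tree_of_data.
Qed.

(** * Codes of products and of forests *)

Lemma vertex_code_mul t1 t2 (q : vertex (tree_mul t1 t2)) x1 x2 :
  vertex_code (val q).1 x1 -> vertex_code (val q).2 x2 -> vertex_code q (dmul x1 x2).
Proof.
elim/data_kids_ind: x1 x2 q => x1 IHx x2 q.
move=> /vertex_codeP[us [us_uniq usE codes1]] /vertex_codeP[ws [ws_uniq wsE codes2]].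
pose ps := [seq (u, w) | u <- us, w <- ws].
have psE p : (p \in ps) = arc p.1 (val q).1 && arc p.2 (val q).2.
  case: p => u w; rewrite -usE -wsE; apply/allpairsP/andP.
    by case=> -[u' w'] [/= uus wws [-> ->]].
  by case=> uus wws; exists (u, w).
have ps_uniq : uniq ps by apply: allpairs_uniq => // -[u w] [u' w'].
(* [insub] drops no pair: the components of [q] have equal depth, hence so have their children. *)
pose qs : seq (prod_vertex t1 t2) := pmap insub ps.
have val_qs : map val qs = ps.
  rewrite /qs (pmap_filter (insubK _)); apply/all_filterP/allP => -[u w].
  rewrite psE /= => /andP[uv wv]; rewrite isSome_insub /=.
  have /eqP-> : depth u == (depth (val q).1).+1 by apply/depthS; exists (val q).1.
  have /eqP-> : depth w == (depth (val q).2).+1 by apply/depthS; exists (val q).2.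
  by rewrite (eqP (valP q)).
apply/vertex_codeP; exists qs; split.
- by rewrite -(map_inj_uniq val_inj) val_qs.
- by move=> p; rewrite -(mem_map val_inj) val_qs psE.
rewrite kids_mul.
(* The claim is stated on plain pairs, which carry no proof of equal depths, so that
   [Forall2_allpairs] applies. *)
suff: List.Forall2 (fun p c => forall r : prod_vertex t1 t2, val r = p ->
    @vertex_code (tree_mul t1 t2) r c) (map val qs)
    [seq dmul a b | a <- kids x1, b <- kids x2].
  by move/Forall2_map => all_codes; apply: Forall2_impl all_codes _ => r c _ _; apply.
rewrite val_qs; apply: Forall2_allpairs codes1 codes2 _ => u c w d cx uc wd r def_r.
by apply: IHx => //; rewrite def_r.
Qed.

Lemma tree_code_mul t1 t2 x1 x2 :
  tree_code t1 x1 -> tree_code t2 x2 -> tree_code (tree_mul t1 t2) (dmul x1 x2).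
Proof. by move=> c1 c2; apply: vertex_code_mul. Qed.

Lemma forest_codeP (A : forest) x : forest_code A x <-> exists ix, [/\ uniq ix,
  forall i : forest_index A, i \in ix
  & List.Forall2 (fun i => tree_code (tree_of i)) ix (kids x)].
Proof.
split=> [[ix [cs [ix_uniq ixE codes ->]]] | [ix [ix_uniq ixE codes]]].
  by exists ix; rewrite dlistK.
by exists ix, (kids x); rewrite kidsK.
Qed.

Lemma forest_code_size (A : forest) a : forest_code A a -> forest_size A = cells a.
Proof.
move/forest_codeP => [ix [ix_uniq ixE codes]].
rewrite /forest_size cellsE -(big_map (fun i => #|vertex (tree_of i)|) xpredT id) /=.
rewrite -(big_map (fun c => (cells c).+1) xpredT id).
have <- := Forall2_map_eq codes (f := fun i => #|vertex (tree_of i)|)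
  (fun i c _ _ ic => card_tree_code ic).
apply: perm_big; apply: perm_map; apply: uniq_perm => //.
  exact: index_enum_uniq.
by move=> i; rewrite mem_index_enum ixE.
Qed.

Lemma forest_code_mul (A B : forest) a b :
  forest_code A a -> forest_code B b -> forest_code (forest_mul A B) (dmul a b).
Proof.
move=> /forest_codeP[ix [ix_uniq ixE codes]] /forest_codeP[jx [jx_uniq jxE codes']].
apply/forest_codeP; exists [seq (i, j) | i <- ix, j <- jx]; split.
- by apply: allpairs_uniq => // -[i j] [i' j'].
- by case=> i j; apply: allpairs_f.
rewrite kids_mul; apply: Forall2_allpairs codes codes' _ => i c j d _.
exact: tree_code_mul.
Qed.

Lemma forest_code_pow (X : forest) x j :
  forest_code X x -> forest_code (forest_pow X j.+1) (dpow x j).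
Proof. by move=> cx; elim: j => //= j IHj; apply: forest_code_mul. Qed.

Lemma forest_code_exists x : exists X, forest_code X x.
Proof.
exists (Forest (fun i : 'I_(size (kids x)) => tree_of_data (nth DNil (kids x) i))).
apply/forest_codeP; exists (enum 'I_(size (kids x))); split=> [||/=]; first exact: enum_uniq.
  by move=> i; rewrite mem_enum.
have codes (T : Type) (h : T -> data) (l : seq T) :
    List.Forall2 (fun i => tree_code (tree_of_data (h i)) ) l (map h l).
  by elim: l => //= i l IHl; constructor=> //; apply: tree_of_dataP.
have := codes _ (fun i : 'I_(size (kids x)) => nth DNil (kids x) i)
  (enum 'I_(size (kids x))).
by rewrite (map_comp (nth DNil (kids x)) val) val_enum_ord map_nth_iota0 ?take_size.
Qed.

Lemma forest_code_iso (A B : forest) a b : forest_code A a -> forest_code B b ->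
  forest_iso A B <-> canon a = canon b.
Proof.
move=> /forest_codeP[ix [ix_uniq ixE codesA]] /forest_codeP[jx [jx_uniq jxE codesB]].
pose n := (cells a + cells b).+1.
pose kA (i : forest_index A) := vcode n (root : vertex (tree_of i)).
pose kB (i : forest_index B) := vcode n (root : vertex (tree_of i)).
have eq_kA : map kA ix = map canon (kids a).
  apply: Forall2_map_eq codesA _ => i c _ ca ic; apply: vertex_code_vcode => //.
  by have := cells_kid ca; rewrite /n; lia.
have eq_kB : map kB jx = map canon (kids b).
  apply: Forall2_map_eq codesB _ => i c _ cb ic; apply: vertex_code_vcode => //.
  by have := cells_kid cb; rewrite /n; lia.
have codeA i : exists2 c, tree_code (tree_of i) c & canon c = kA i.
  have [c ca ic] := Forall2_mem codesA (ixE i); exists c => //.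
  by apply/esym/vertex_code_vcode => //; have := cells_kid ca; rewrite /n; lia.
have codeB i : exists2 c, tree_code (tree_of i) c & canon c = kB i.
  have [c cb ic] := Forall2_mem codesB (jxE i); exists c => //.
  by apply/esym/vertex_code_vcode => //; have := cells_kid cb; rewrite /n; lia.
split=> [[f [bij_f iso_f]] | /canonP].
  apply/canonP; rewrite -eq_kA -eq_kB.
  have kf i : kA i = kB (f i).
    have [c ci <-] := codeA i; have [d di <-] := codeB (f i).
    exact: tree_code_iso (iso_f i).
  rewrite (eq_map kf) (map_comp kB f); apply: perm_map; apply: uniq_perm => //.
    by rewrite map_inj_uniq //; apply: bij_inj.
  by case: bij_f => g _ fK j; rewrite jxE -[j]fK map_f.
rewrite -eq_kA -eq_kB => prm.
(* Trees of equal rank in the order of their codes are matched. *)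
pose sA := sort (relpre kA geD) ix; pose sB := sort (relpre kB geD) jx.
have eq_s : map kA sA = map kB sB.
  rewrite -!sort_map; apply/perm_sortP => //.
  - exact: geD_total.
  - exact: geD_trans.
  - exact: geD_anti.
have size_s : size sA = size sB by rewrite -(size_map kA) eq_s size_map.
have sAE i : i \in sA by rewrite mem_sort.
have sBE i : i \in sB by rewrite mem_sort.
have ex_f i : exists j, index j sB = index i sA.
  have: index i sA < size sB by rewrite -size_s index_mem.
  case def_sB: sB => [|j0 s0] // lt_i; exists (nth j0 (j0 :: s0) (index i sA)).
  by rewrite index_uniq // -def_sB sort_uniq.
have [f fE] := fin_all_exists ex_f; exists f; split=> [|i]; last first.
  have [c ci kc] := codeA i; have [d di kd] := codeB (f i).
  apply: tree_code_inj ci di _; rewrite kc kd.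
  have -> : kA i = nth DNil (map kA sA) (index i sA).
    by rewrite (nth_map i) ?index_mem // nth_index.
  have -> : kB (f i) = nth DNil (map kB sB) (index (f i) sB).
    by rewrite (nth_map (f i)) ?index_mem // nth_index.
  by rewrite eq_s fE.
apply: inj_card_bij => [i i' eq_f|].
  by rewrite -(nth_index i (sAE i)) -(nth_index i (sAE i')) -!fE eq_f.
have card_s (T : finType) (r : seq T) : uniq r -> (forall i, i \in r) -> #|T| = size r.
  by move=> r_uniq rE; rewrite -(card_uniqP r_uniq); apply: eq_card => i; rewrite rE.
by rewrite (card_s _ sA) ?(card_s _ sB) ?sort_uniq // size_s.
Qed.

(** * Correctness and cubic running time of the solver *)

Theorem theorem4 :
  exists (P : program) (C : nat),
    forall (A : forest) (k : nat) (a : data),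
      forest_code A a ->
      0 < k ->
      k <= trunc_log 2 (forest_size A) ->
      exists (v : data) (n : nat),
        [/\ computes_in P [:: a; unary k] v n,
            n <= C * forest_size A ^ 3
          & (exists (X : forest) (x : data),
               [/\ v = dlist [:: x], forest_code X x
                 & forest_iso (forest_pow X k) A]) \/
            (v = dlist [::] /\
             ~ exists X : forest, forest_iso (forest_pow X k) A)].
Proof.
(* The factor [100 * 100] comes from [calls_main], and 8 from [(m + 1)^3 <= 8 m^3] for [m >= 1]. *)
exists solver, (8 * (100 * 100)) => A [//|j] a code_a _.
rewrite (forest_code_size code_a) => le_j.
(* For [m = 0] the logarithm is 0, which is less than [j.+1]. *)
have m_gt0 : 0 < cells a by case: (cells a) le_j.
have le_jm : j <= cells a.
  have := trunc_logP (isT : 1 < 2) m_gt0.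
  by have := ltn_expl (trunc_log 2 (cells a)) (isT : 1 < 2); lia.
have [n run_n le_n] := calls_main le_jm.
move: run_n; set o := checked_root _ _ _ _ => run_n.
exists (option_code o), n; split=> //.
  have le_cube : (cells a).+1 * (cells a).+1 * (cells a).+1 <= 8 * cells a ^ 3.
    rewrite -[8]/(2 ^ 3) -expnMn !expnS expn0 muln1 -mulnA.
    by rewrite !leq_mul //; lia.
  by apply: leq_trans le_n _; move: (cells a ^ 3) le_cube => c; lia.
have powP (X : forest) x : forest_code X x ->
    forest_iso (forest_pow X j.+1) A <-> canon (dpow x j) = canon a.
  by move=> code_x; apply: forest_code_iso => //; apply: forest_code_pow.
case def_o: o => [x|]; [left | right; split=> // -[X iso_X]].
  have [X code_x] := forest_code_exists x; exists X, x; split=> //.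
  by apply/(powP X x code_x); apply: checked_root_Some def_o.
(* A root [X] would have a code, and completeness would make the result [Some]. *)
have [x code_x] := forest_code_ex X.
have le_a : cells (canon a) <= cells a by rewrite cells_canon.
have [y] := checked_root_complete (canon_id a) le_a ((powP X x code_x).1 iso_X).
by rewrite -/o def_o.
Qed.
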